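(* Let $\varphi\in L^2(\mathbb{H}^n)$ and assume that $\{L_{(2k,l,m)}\varphi:(k,l,m)\in\mathbb{Z}^{2n+1}\}$ is a frame for $V(\varphi)$. Then there exists a function $\tilde\varphi\in V(\varphi)$ such that $$f=\sum_{(k,l,m)\in\mathbb{Z}^{2n+1}}\langle f,L_{(2k,l,m)}\tilde\varphi\rangle L_{(2k,l,m)}\varphi\quad\forall f\in V(\varphi),$$ namely $\tilde\varphi=S^{-1}\varphi$, where $S$ is the frame operator corresponding to the frame $\{L_{(2k,l,m)}\varphi:(k,l,m)\in\mathbb{Z}^{2n+1}\}$.
   Context: A countable family $\{f_k\}$ in a separable Hilbert space $\mathcal{H}$ is a frame for $\mathcal{H}$ if there are $A,B>0$ with $A\|f\|^2\le\sum_k|\langle f,f_k\rangle|^2\le B\|f\|^2$ for all $f\in\mathcal{H}$; its frame operator is $S:\mathcal{H}\to\mathcal{H}$, $Sf=\sum_k\langle f,f_k\rangle f_k$, which is bounded, invertible, self-adjoint and positive. Here $\mathcal{H}=V(\varphi)$. The Heisenberg group $\mathbb{H}^n$ is $\mathbb{C}^n\times\mathbb{R}$ with group law $(z,t).(w,s)=(z+w,\,t+s+\frac12\mathrm{Im}(z.\overline{w}))$ and Haar measure $dz\,dt$. Writing $z=x+iy$, points are also written $(x,y,t)$. For $(k,l,m)\in\mathbb{Z}^n\times\mathbb{Z}^n\times\mathbb{Z}$, $L_{(2k,l,m)}\varphi(X)=\varphi((2k,l,m)^{-1}.X)$, and $V(\varphi)=\overline{\mathrm{span}}\{L_{(2k,l,m)}\varphi:(k,l,m)\in\mathbb{Z}^{2n+1}\}$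 in $L^2(\mathbb{H}^n)$. *)

(* Defs.v *)
From HB Require Import structures.
From mathcomp Require Import all_boot all_order all_algebra finmap.
From mathcomp Require Import all_classical all_reals all_analysis. 
From mathcomp Require Import measurable_realfun summability.
From mathcomp Require Import complex ring.

Set Implicit Arguments.
Unset Strict Implicit.
Unset Printing Implicit Defensive.

Import Order.TTheory GRing.Theory Num.Theory.
Import numFieldNormedType.Exports.
Import ComplexField Normc.

Local Open Scope classical_set_scope.
Local Open Scope ring_scope.
Local Open Scope complex_scope.

Lemma product_sigma_finite d1 d2 (T1 : measurableType d1)
    (T2 : measurableType d2) (R : realType)
    (m1 : {sigma_finite_measure set T1 -> \bar R})
    (m2 : {sigma_finite_measure set T2 -> \bar R}) :
  sigma_finite setT (m1 \x m2)%E.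
Proof.
have /sigma_finiteP[F [TF ndF Foo]] := sigma_finiteT m1.
have /sigma_finiteP[G [TG ndG Goo]] := sigma_finiteT m2.
exists (fun n => F n `*` G n).
  rewrite -setXTT TF TG; apply/seteqP; split=> -[x y] /=; last first.
    by move=> [n _ []]; split; exists n.
  move=> [[n _ Fnx] [k _ Gky]]; exists (maxn n k) => //; split.
  - by move: x Fnx; exact/subsetPset/ndF/leq_maxl.
  - by move: y Gky; exact/subsetPset/ndG/leq_maxr.
move=> k; have [? ?] := Foo k; have [? ?] := Goo k.
split; first exact: measurableX.
by rewrite product_measure1E// lte_mul_pinfty// ge0_fin_numE.
Qed.

Local Notation Re := (@complex.Re _).
Local Notation Im := (@complex.Im _).
Local Notation normc := (@Normc.normc _).

Section tuple_measure.
Context {R : realType}.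
Local Notation RT := (measurableTypeR R).

Definition tuple_cons n (p : RT * n.-tuple RT) : n.+1.-tuple RT :=
  [the n.+1.-tuple RT of p.1 :: p.2].

Lemma measurable_tuple_cons n : measurable_fun setT (@tuple_cons n).
Proof. by apply: (measurable_cons measurable_fst measurable_snd). Qed.

HB.instance Definition _ n :=
  isMeasurableFun.Build _ _ _ _ (@tuple_cons n) (@measurable_tuple_cons n).

Section cons.
Context {n : nat} (mu : {sigma_finite_measure set (n.-tuple RT) -> \bar R}).

Definition cons_measure : set (n.+1.-tuple RT) -> \bar R :=
  pushforward (@lebesgue_measure R \x mu)%E (@tuple_cons n).

Let cons0 : cons_measure set0 = 0%E.
Proof. exact: measure0. Qed.

Let cons_ge0 A : (0 <= cons_measure A)%E.
Proof. exact: measure_ge0. Qed.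

Let cons_sigma_additive : semi_sigma_additive cons_measure.
Proof. exact: measure_semi_sigma_additive. Qed.

HB.instance Definition _ := isMeasure.Build _ _ _ cons_measure
  cons0 cons_ge0 cons_sigma_additive.

Let uncons (t : n.+1.-tuple RT) : RT * n.-tuple RT :=
  (thead t, [tuple of behead t]).

Let cons_sigma_finite : sigma_finite setT cons_measure.
Proof.
have [F FT Foo] := product_sigma_finite (@lebesgue_measure R) mu.
have unconsK p : uncons (tuple_cons p) = p.
  case: p => x t; rewrite /uncons /tuple_cons theadE; congr pair.
  exact/val_inj.
have mu_ : measurable_fun setT uncons.
  apply: measurable_fun_pair; first exact: measurable_tnth.
  exact: measurable_behead.
exists (fun i => uncons @^-1` F i).
  by rewrite -preimage_bigcup -FT preimage_setT.
move=> i; have [mF Fi] := Foo i; split.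
  by rewrite -[X in measurable X]setTI; exact: mu_.
rewrite /cons_measure /pushforward -comp_preimage.
by rewrite (_ : uncons \o _ = id) ?preimage_id//; apply/funext.
Qed.

HB.instance Definition _ :=
  Measure_isSigmaFinite.Build _ _ _ cons_measure cons_sigma_finite.
End cons.

Fixpoint lebesgue_tuple n : {sigma_finite_measure set (n.-tuple RT) -> \bar R} :=
  if n is m.+1 then cons_measure (lebesgue_tuple m)
  else \d_([tuple] : 0.-tuple RT).
End tuple_measure.


Section measure_preserving.
Context {R : realType}.
Local Notation RT := (measurableTypeR R).

Definition preserves d (T : measurableType d) (m : set T -> \bar R)
    (h : T -> T) := forall A, measurable A -> m (h @^-1` A) = m A.

Lemma lebesgue_shift (c : R) :
  preserves (@lebesgue_measure R) (fun x : RT => x + c : RT).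
Proof.
move=> A mA; set h := fun x : RT => x + c : RT.
have mh : measurable_fun setT h by exact: measurable_funD.
pose hm : {mfun RT >-> RT} := mfun_Sub (mem_set mh).
rewrite -[LHS]/(pushforward (@lebesgue_measure R) hm A); symmetry.
apply: lebesgue_measure_unique => // X -[[a b] _ <-] /=.
transitivity (@lebesgue_measure R `]a - c, b - c]%classic); last first.
  congr (_ _).
  by apply/seteqP; split=> x /=; rewrite !in_itv/= ltrBlDr lerBrDr.
rewrite !lebesgue_measure_itv/= !lte_fin ltrD2r.
by rewrite -!EFinB opprB addrA subrK.
Qed.

Lemma prod_skew d1 d2 (T1 : measurableType d1) (T2 : measurableType d2)
    (m1 : {sigma_finite_measure set T1 -> \bar R})
    (m2 : {sigma_finite_measure set T2 -> \bar R})
    (h1 : T1 -> T1) (h2 : T1 -> T2 -> T2) :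
  measurable_fun setT h1 ->
  measurable_fun setT (fun p : T1 * T2 => h2 p.1 p.2) ->
  preserves m1 h1 -> (forall x, preserves m2 (h2 x)) ->
  preserves (m1 \x m2)%E (fun p => (h1 p.1, h2 p.1 p.2)).
Proof.
move=> mh1 mh2 p1 p2 A mA; set h := fun p : T1 * T2 => _.
have mh : measurable_fun setT h.
  by apply: measurable_fun_pair => //; exact: measurableT_comp.
pose hm : {mfun (T1 * T2)%type >-> (T1 * T2)%type} := mfun_Sub (mem_set mh).
rewrite -[LHS]/(pushforward (m1 \x m2)%E hm A).
symmetry; apply: product_measure_unique => // A1 A2 mA1 mA2.
rewrite -[LHS]/(\int[m1]_x m2 (xsection (h @^-1` (A1 `*` A2)) x))%E.
rewrite (eq_integral (fun x => (m2 A2 * (\1_(h1 @^-1` A1) x)%:E)%E)); last first.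
  move=> x _ /=; rewrite indicE; have [xA|xA] := boolP (x \in _).
    rewrite mule1 -(p2 x _ mA2); congr (m2 _); apply/seteqP; split=> y /=.
      by rewrite /xsection/= inE /= => -[].
    rewrite /xsection/= inE => Hy; split => //.
    by rewrite inE in xA.
  rewrite mule0 -(measure0 m2); congr (m2 _); apply/seteqP; split=> y //=.
  by rewrite /xsection/= inE /= => -[Hx]; rewrite notin_setE in xA.
have mA1' : measurable (h1 @^-1` A1).
  by rewrite -[X in measurable X]setTI; exact: mh1.
rewrite ge0_integralZl//=; [|try exact/measurable_EFinP..].
have <- : m1 (h1 @^-1` A1) = m1 A1 by exact: p1.
by rewrite integral_indic// setIT muleC.
Qed.

Lemma tuple_shift n (a : n.-tuple RT) :
  preserves (lebesgue_tuple n)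
    (fun x : n.-tuple RT => [tuple tnth x i + tnth a i | i < n]).
Proof.
elim: n a => [|n IH] a A mA.
  congr (_ _); rewrite [X in X @^-1` _](_ : _ = id) ?preimage_id//.
  by apply/funext => x; rewrite [LHS]tuple0 [RHS]tuple0.
set sh := (X in X @^-1` A).
pose sh' := fun p : RT * n.-tuple RT => (p.1 + thead a : RT,
  [tuple tnth p.2 i + tnth [tuple of behead a] i | i < n] : n.-tuple RT).
have shE p : sh (tuple_cons p) = tuple_cons (sh' p).
  case: p => x y; apply: eq_from_tnth => i.
  have [j ->|->] := unliftP ord0 i; last by rewrite tnth_mktuple.
  rewrite tnth_mktuple !tnthS tnth_mktuple.
  by rewrite [in X in _ + X = _](tuple_eta a) tnthS.
have E : @tuple_cons R n @^-1` (sh @^-1` A) = sh' @^-1` (@tuple_cons R n @^-1` A).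
  by apply/funext => p; rewrite /preimage/= shE.
rewrite -[LHS]/((@lebesgue_measure R \x lebesgue_tuple n)%E
    (@tuple_cons R n @^-1` (sh @^-1` A))) E.
apply: (@prod_skew _ _ _ _ (@lebesgue_measure R) (lebesgue_tuple n)
  (fun x => x + thead a)
  (fun _ y => [tuple tnth y i + tnth [tuple of behead a] i | i < n])).
- exact: measurable_funD.
- apply/measurable_fun_tnthP => i /=.
  rewrite (_ : _ \o _ = fun p : RT * n.-tuple RT => tnth p.2 i + tnth [tuple of behead a] i); last first.
    by apply/funext => p /=; rewrite tnth_mktuple.
  apply: measurable_funD => //.
  exact: (measurableT_comp (measurable_tnth i) measurable_snd).
- move=> B mB; exact: lebesgue_shift.
- by move=> _ B mB; exact: IH.
- by rewrite -[X in measurable X]setTI; exact: measurable_tuple_cons.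
Qed.

End measure_preserving.

Section L2fun.
Context {d} {T : measurableType d} {R : realType}.
Variable mu : {measure set T -> \bar R}.

Definition L2pred : {pred (T -> R[i])} := mem [set f : T -> R[i] |
  [/\ measurable_fun setT (Re \o f), measurable_fun setT (Im \o f) &
      finite_norm mu 2%:E (normc \o f)]].

Lemma normc_ge0 (x : R[i]) : 0 <= normc x.
Proof. by case: x => a b; exact: sqrtr_ge0. Qed.

Lemma measurable_normc (f : T -> R[i]) :
  measurable_fun setT (Re \o f) -> measurable_fun setT (Im \o f) ->
  measurable_fun setT (normc \o f).
Proof.
move=> mr mi; rewrite (_ : normc \o f =
    (@Num.sqrt R) \o (fun x => (Re (f x)) ^+ 2 + (Im (f x)) ^+ 2)); last first.
  by apply/funext => x /=; case: (f x).
apply: measurableT_comp.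
  by apply: continuous_measurable_fun; exact: sqrt_continuous.
by apply: measurable_funD; apply: measurable_funX.
Qed.

Let le12 : (1 <= 2%:E :> \bar R)%E. Proof. by rewrite lee_fin ler1n. Qed.

Lemma le_Lnorm2 (f g : T -> R) :
  measurable_fun setT f -> measurable_fun setT g ->
  (\forall x \ae mu, `|f x| <= `|g x|) ->
  ('N[mu]_2%:E[EFin \o f] <= 'N[mu]_2%:E[EFin \o g])%E.
Proof.
move=> mf mg fg.
have mE (h : T -> R) : measurable_fun setT h ->
    measurable_fun setT (fun x => `|(h x)%:E| `^ 2)%E.
  move=> mh; apply: (measurableT_comp (measurable_poweR 2)).
  by apply: measurableT_comp => //; exact/measurable_EFinP.
rewrite unlock; apply: gt0_ler_poweR => //=.
- by rewrite in_itv/= integral_ge0 ?leey// => x _; exact: poweR_ge0.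
- by rewrite in_itv/= integral_ge0 ?leey// => x _; exact: poweR_ge0.
apply: ae_ge0_le_integral => [//|x _||x _||].
- by rewrite lee_fin powR_ge0.
- exact: mE.
- by rewrite lee_fin powR_ge0.
- exact: mE.
apply: filterS fg => x fgx _.
by rewrite lee_fin; apply: ge0_ler_powR; rewrite ?nnegrE.
Qed.

Lemma L2predP (f : T -> R[i]) : f \in L2pred -> normc \o f \in Lfun mu 2%:E.
Proof.
rewrite inE => -[mr mi nf]; rewrite inE; apply/andP; split; rewrite inE//=.
exact: measurable_normc.
Qed.

Lemma L2_submod_closed : submod_closed L2pred.
Proof.
split.
  rewrite inE; split=> /=; [exact: measurable_cst..|].
  rewrite (_ : _ \o _ = cst 0); first exact: finite_norm_cst0.
  by apply/funext => x; exact: normc0.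
move=> a f g fL gL; rewrite inE.
have nf := L2predP fL; have ng := L2predP gL.
move: fL gL; rewrite !inE => -[fr fi _] [gr gi _].
have mr : measurable_fun setT (Re \o (a *: f + g)).
  rewrite (_ : _ \o _ = (fun x =>
      Re a * Re (f x) - Im a * Im (f x) + Re (g x))); last first.
    by apply/funext => x /=; rewrite !fctE; case: (a) (f x) (g x) => ? ? [? ?] [].
  by apply: measurable_funD => //; apply: measurable_funB;
    apply: measurable_funM.
have mi : measurable_fun setT (Im \o (a *: f + g)).
  rewrite (_ : _ \o _ = (fun x =>
      Re a * Im (f x) + Im a * Re (f x) + Im (g x))); last first.
    by apply/funext => x /=; rewrite !fctE; case: (a) (f x) (g x) => ? ? [? ?] [].
  by apply: measurable_funD => //; apply: measurable_funD;
    apply: measurable_funM.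
split => //.
have [_ lin] := Lfun_submod_closed mu le12.
have := lin (normc a) _ _ nf ng; rewrite inE => /andP[]; rewrite !inE => mfg.
apply: le_lt_trans; apply: le_Lnorm2 => //; first exact: measurable_normc.
apply/aeW => x /=; rewrite !fctE.
rewrite !ger0_norm ?addr_ge0 ?mulr_ge0 ?normc_ge0//.
by rewrite (le_trans (le_normcD _ _))// lerD2r normcM.
Qed.

HB.instance Definition _ :=
  GRing.isSubmodClosed.Build R[i] (T -> R[i]) L2pred L2_submod_closed.

Record L2fun := MkL2fun { L2fun_val :> T -> R[i]; _ : L2fun_val \in L2pred }.
HB.instance Definition _ := [isSub for L2fun_val].
HB.instance Definition _ := [Choice of L2fun by <:].
HB.instance Definition _ := [SubChoice_isSubLmodule of L2fun by <:].

Definition null_fun : {pred L2fun} :=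
  mem [set f : L2fun | \forall x \ae mu, f x = 0].

Lemma null_zmod_closed : zmod_closed null_fun.
Proof.
split; first by rewrite inE; exact/aeW.
move=> f g; rewrite !inE /=; apply: filterS2 => x.
by rewrite /= !fctE => -> ->; rewrite subrr.
Qed.
HB.instance Definition _ := GRing.isZmodClosed.Build L2fun null_fun null_zmod_closed.

Definition L2 := Quotient.quot null_fun.
HB.instance Definition _ := GRing.Zmodule.on L2.
HB.instance Definition _ := EqQuotient.on L2.

Local Open Scope quotient_scope.

Lemma L2P (f g : L2fun) :
  reflect (\forall x \ae mu, f x = g x) (f == g %[mod L2]).
Proof.
rewrite -Quotient.idealrBE; apply: (iffP idP).
  by rewrite inE; apply: filterS => x; rewrite /= !fctE => /eqP; rewrite subr_eq0 => /eqP.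
by move=> fg; rewrite inE; apply: filterS fg => x; rewrite /= !fctE => ->; rewrite subrr.
Qed.

Lemma L2_reprP (f : L2fun) : \forall x \ae mu, repr (\pi_L2 f) x = f x.
Proof. by apply/L2P; rewrite reprK. Qed.

Definition L2scale (a : R[i]) (u : L2) : L2 := \pi_L2 (a *: repr u).

Lemma pi_L2scale a f : L2scale a (\pi_L2 f) = \pi_L2 (a *: f).
Proof.
apply/eqP/L2P; apply: filterS (L2_reprP f) => x.
by rewrite /= !fctE => ->.
Qed.

Lemma L2scaleA a b u : L2scale a (L2scale b u) = L2scale (a * b) u.
Proof. by rewrite /L2scale -/(L2scale _ _) pi_L2scale scalerA. Qed.
Lemma L2scale1 : left_id 1 L2scale.
Proof. by move=> u; rewrite /L2scale scale1r reprK. Qed.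
Lemma L2scaleDr : right_distributive L2scale +%R.
Proof.
move=> a u v; rewrite -[u]reprK -[v]reprK -raddfD !pi_L2scale -raddfD.
by rewrite scalerDr.
Qed.
Lemma L2scaleDl u : {morph L2scale^~ u : a b / a + b}.
Proof. by move=> a b; rewrite /L2scale scalerDl raddfD. Qed.

HB.instance Definition _ :=
  GRing.Zmodule_isLmodule.Build R[i] L2 L2scaleA L2scale1 L2scaleDr L2scaleDl.

Definition L2norm (u : L2) : R := fine 'N[mu]_2%:E[EFin \o normc \o repr u]%E.

Lemma L2funP (f : L2fun) : normc \o f \in Lfun mu 2%:E.
Proof. by apply: L2predP; exact: valP. Qed.

Lemma measurable_normc_L2fun (f : L2fun) : measurable_fun setT (normc \o f).
Proof. by have := valP f; rewrite inE => -[? ? _]; exact: measurable_normc. Qed.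

Lemma pi_L2normE f : (L2norm (\pi_L2 f))%:E = 'N[mu]_2%:E[EFin \o normc \o f]%E.
Proof.
rewrite /L2norm (_ : Lnorm _ _ _ = 'N[mu]_2%:E[EFin \o normc \o f]%E).
  have := L2funP f; rewrite inE => /andP[_]; rewrite inE => /= nf.
  by rewrite fineK// ge0_fin_numE ?Lnorm_ge0.
apply/eqP; rewrite eq_le; apply/andP; split; apply: le_Lnorm2 => //;
  try exact: measurable_normc_L2fun.
- by apply: filterS (L2_reprP f) => x /= ->.
- by apply: filterS (L2_reprP f) => x /= ->.
Qed.

Lemma ler_L2normD u v : L2norm (u + v) <= L2norm u + L2norm v.
Proof.
rewrite -[u]reprK -[v]reprK -raddfD -lee_fin EFinD !pi_L2normE.
move: (repr u) (repr v) => f g.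
apply: le_trans; last first.
  apply: (@eminkowski _ _ _ mu (normc \o f) (normc \o g)) => //;
    exact: measurable_normc_L2fun.
apply: le_Lnorm2; first exact: measurable_normc_L2fun.
  by apply: measurable_funD; exact: measurable_normc_L2fun.
apply/aeW => x /=; rewrite !ger0_norm ?addr_ge0 ?normc_ge0//.
exact: le_normcD.
Qed.

Lemma L2normZ a u : L2norm (a *: u) = normc a * L2norm u.
Proof.
rewrite -[u]reprK -[_ *: _]/(L2scale _ _) pi_L2scale.
apply: EFin_inj; rewrite EFinM !pi_L2normE.
move: (repr u) => f.
have -> : EFin \o normc \o (a *: f : L2fun) = EFin \o (normc a \*: (normc \o f)).
  by apply/funext => x /=; rewrite normcM.
have := LnormZ (Lfun_Sub le12 (L2funP f)) (normc a).
by rewrite ger0_norm ?normc_ge0.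
Qed.

Lemma L2norm_eq0 u : L2norm u = 0 -> u = 0.
Proof.
rewrite -[u]reprK; move: (repr u) => f uf0.
have nf0 : 'N[mu]_2%:E[EFin \o normc \o f]%E = 0%E by rewrite -pi_L2normE uf0.
 rewrite -[RHS](raddf0 (\pi_L2 : {additive L2fun -> L2})).
apply/eqP/L2P.
have mf : measurable_fun setT (EFin \o normc \o f).
  by apply/measurable_EFinP; exact: measurable_normc_L2fun.
have : (0 < 2%:E :> \bar R)%E by rewrite lte_fin.
move=> /(Lnorm_eq0_eq0 mf)/(_ nf0); apply: filterS.
by move=> x /= /(_ I) [] /eq0_normc.
Qed.

Let ler_norm u v : (L2norm (u + v))%:C <= (L2norm u)%:C + (L2norm v)%:C.
Proof. by rewrite -raddfD lecR ler_L2normD. Qed.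

Let normZ a u : (L2norm (a *: u))%:C = `|a| * (L2norm u)%:C.
Proof. by rewrite L2normZ rmorphM; case: a. Qed.

Let norm_eq0 u : (L2norm u)%:C = 0 -> u = 0.
Proof. by move=> /complexI; exact: L2norm_eq0. Qed.

HB.instance Definition _ := Lmodule_isNormed.Build R[i] L2 ler_norm normZ norm_eq0.
Definition L2dot (u v : L2) : R[i] :=
  (\int[mu]_x Re (repr u x * (repr v x)^*)) +i*
  (\int[mu]_x Im (repr u x * (repr v x)^*)).

End L2fun.

Section L2comp.
Context {d} {T : measurableType d} {R : realType}.
Variable mu : {measure set T -> \bar R}.
Variables (h : T -> T) (mh : measurable_fun setT h) (ph : preserves mu h).

Lemma Lnorm_comp (f : T -> \bar R) : measurable_fun setT f ->
  'N[mu]_2%:E[f \o h]%E = 'N[mu]_2%:E[f]%E.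
Proof.
move=> mf; rewrite unlock; congr (_ `^ _)%E.
have mF : measurable_fun setT (fun x => `|f x| `^ 2)%E.
  apply: (measurableT_comp (measurable_poweR 2)).
  exact: measurableT_comp.
rewrite -(@ge0_integral_pushforward _ _ _ _ _ _ mh mu setT
  (fun x => `|f x| `^ 2)%E)//.
  by apply: eq_measure_integral => A mA _; exact: ph.
by move=> x _; exact: poweR_ge0.
Qed.

Lemma L2pred_comp (f : T -> R[i]) : f \in L2pred mu -> f \o h \in L2pred mu.
Proof.
rewrite !inE => -[mr mi nf]; split.
- exact: (measurableT_comp mr mh).
- exact: (measurableT_comp mi mh).
rewrite /finite_norm.
rewrite -[EFin \o _]/((EFin \o normc \o f) \o h) Lnorm_comp//.
by apply/measurable_EFinP; exact: measurable_normc.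
Qed.

Definition L2fun_comp (f : L2fun mu) : L2fun mu := MkL2fun (L2pred_comp (valP f)).

Definition L2comp (u : L2 mu) : L2 mu := \pi_(L2 mu)%qT (L2fun_comp (repr u)).

Lemma pi_L2comp (f : L2fun mu) :
  L2comp (\pi_(L2 mu)%qT f) = \pi_(L2 mu)%qT (L2fun_comp f).
Proof.
apply/eqP/L2P; have [N [mN N0 fN]] := L2_reprP f.
exists (h @^-1` N); split.
- by rewrite -[X in measurable X]setTI; exact: mh.
- by rewrite ph.
- by move=> x /= hx; apply: fN.
Qed.

End L2comp.

Section heisenberg.
Variables (R : realType) (n : nat).
Local Notation RT := (measurableTypeR R).
Local Notation Rn := (n.-tuple RT).

(* [(x, y)] stands for $x + iy \in \mathbb{C}^n$ *)
Definition lebesgue_Cn : set (Rn * Rn)%type -> \bar R :=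
  (lebesgue_tuple n \x lebesgue_tuple n)%E.
HB.instance Definition _ := Measure.on lebesgue_Cn.
HB.instance Definition _ := Measure_isSigmaFinite.Build _ _ _ lebesgue_Cn
  (product_sigma_finite (lebesgue_tuple n) (lebesgue_tuple n)).

Definition heis : measurableType _ := ((Rn * Rn) * RT)%type.

Definition haar : set heis -> \bar R := (lebesgue_Cn \x @lebesgue_measure R)%E.
HB.instance Definition _ := Measure.on haar.

Definition tuple_add (x y : Rn) : Rn := [tuple tnth x i + tnth y i | i < n].
Definition tuple_opp (x : Rn) : Rn := [tuple - tnth x i | i < n].

(* $z \cdot \overline{w}$ *)
Definition hermC (z w : Rn * Rn) : R[i] :=
  \sum_(j < n) (tnth z.1 j +i* tnth z.2 j) * (tnth w.1 j +i* tnth w.2 j)^*.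

Definition hmul (X Y : heis) : heis :=
  ((tuple_add X.1.1 Y.1.1, tuple_add X.1.2 Y.1.2),
   X.2 + Y.2 + 2^-1 * Im (hermC X.1 Y.1)).
Definition hone : heis := ([tuple 0 | _ < n], [tuple 0 | _ < n], 0).
Definition hinv (X : heis) : heis :=
  ((tuple_opp X.1.1, tuple_opp X.1.2), - X.2).

Lemma Im_hermC z w : Im (hermC z w) =
  \sum_(j < n) (tnth z.2 j * tnth w.1 j - tnth z.1 j * tnth w.2 j).
Proof.
rewrite /hermC; elim/big_rec2: _ => // j b a _ <-.
by case: a => a1 a2 /=; rewrite mulrN addrC [in RHS]addrC [- _ + _]addrC.
Qed.

Lemma hmulVx X : hmul (hinv X) X = hone.
Proof.
case: X => [[x y] t]; rewrite /hmul /hinv /hone /= Im_hermC.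
congr (_, _, _); first by apply: eq_from_tnth => i; rewrite !tnth_mktuple addNr.
  by apply: eq_from_tnth => i; rewrite !tnth_mktuple addNr.
rewrite addNr add0r big1 ?mulr0// => j _.
by rewrite /= !tnth_mktuple; ring.
Qed.

Lemma hmulxV X : hmul X (hinv X) = hone.
Proof.
case: X => [[x y] t]; rewrite /hmul /hinv /hone /= Im_hermC.
congr (_, _, _); first by apply: eq_from_tnth => i; rewrite !tnth_mktuple subrr.
  by apply: eq_from_tnth => i; rewrite !tnth_mktuple subrr.
rewrite subrr add0r big1 ?mulr0// => j _.
by rewrite /= !tnth_mktuple; ring.
Qed.

Let hmul1 (X : heis) (z : Rn * Rn) :=
  (tuple_add X.1.1 z.1, tuple_add X.1.2 z.2).

Let measurable_tuple_add (a : Rn) : measurable_fun setT (tuple_add a).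
Proof.
apply/measurable_fun_tnthP => i.
rewrite (_ : _ \o _ = fun x : Rn => tnth a i + tnth x i); last first.
  by apply/funext => p /=; rewrite tnth_mktuple.
by apply: measurable_funD => //; exact: measurable_tnth.
Qed.

Let measurable_hmul1 X : measurable_fun setT (hmul1 X).
Proof.
apply: measurable_fun_pair => /=.
  exact: (measurableT_comp (measurable_tuple_add _) measurable_fst).
exact: (measurableT_comp (measurable_tuple_add _) measurable_snd).
Qed.

Let measurable_hmul2 X : measurable_fun setT (fun Y : (Rn * Rn) * RT =>
  X.2 + Y.2 + 2^-1 * Im (hermC X.1 Y.1)).
Proof.
apply: measurable_funD; first exact: measurable_funD.
apply: measurable_funM => //; under eq_fun do rewrite Im_hermC.
apply: measurable_sum => j; apply: measurable_funB; apply: measurable_funM => //.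
  apply: (measurableT_comp (measurable_tnth j)).
  exact: (measurableT_comp measurable_fst measurable_fst).
apply: (measurableT_comp (measurable_tnth j)).
exact: (measurableT_comp measurable_snd measurable_fst).
Qed.

Lemma measurable_hmul X : measurable_fun setT (hmul X).
Proof.
apply: measurable_fun_pair; last exact: measurable_hmul2.
exact: (measurableT_comp (measurable_hmul1 X) measurable_fst).
Qed.

Lemma haar_left_invariant X : preserves haar (hmul X).
Proof.
move=> A mA; apply: (@prod_skew _ _ _ _ _ lebesgue_Cn (@lebesgue_measure R)
  (hmul1 X) (fun z t => X.2 + t + 2^-1 * Im (hermC X.1 z))) => //.
- exact: measurable_hmul2.
- have tuple_addE a : preserves (lebesgue_tuple n) (tuple_add a).
    rewrite (_ : tuple_add a =
        fun x => [tuple tnth x i + tnth a i | i < n]); first exact: tuple_shift.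
    apply/funext => x; apply: eq_from_tnth => i.
    by rewrite !tnth_mktuple addrC.
  apply: (@prod_skew _ _ _ _ _ (lebesgue_tuple n) (lebesgue_tuple n)
    (tuple_add X.1.1) (fun _ => tuple_add X.1.2)) => //.
  exact: (measurableT_comp (measurable_tuple_add _) measurable_snd).
- move=> z.
  rewrite (_ : (fun t => _) =
      fun t => t + (X.2 + 2^-1 * Im (hermC X.1 z))); first exact: lebesgue_shift.
  by apply/funext => t; rewrite addrAC addrC.
Qed.

Definition translation (X : heis) : L2 haar -> L2 haar :=
  L2comp (measurable_hmul (hinv X)) (@haar_left_invariant (hinv X)).

Definition lattice := ((n.-tuple int * n.-tuple int) * int)%type.

Definition lattice_point (p : lattice) : heis :=
  (([tuple 2 * (tnth p.1.1 i)%:~R | i < n], [tuple (tnth p.1.2 i)%:~R | i < n]),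
   (p.2)%:~R).

Definition translates (phi : L2 haar) (p : lattice) : L2 haar :=
  translation (lattice_point p) phi.

End heisenberg.

Section frame.
Context {R : realType} {H : normedModType R[i]} {I : countType}.
Variable dot : H -> H -> R[i].

Definition closed_span (F : I -> H) : set H :=
  closure [set f | exists (A : {fset I}) (c : I -> R[i]),
    f = \sum_(i <- A) c i *: F i].

Definition is_frame (V : set H) (F : I -> H) :=
  (forall i, V (F i)) /\
  exists A B : R, [/\ 0 < A, 0 < B & forall f, V f ->
    ((A * (Re `|f|) ^+ 2)%:E <=
       \esum_(i in [set: I]) ((Re `|dot f (F i)|) ^+ 2)%:E <=
     (B * (Re `|f|) ^+ 2)%:E)%E].

Definition frame_operator (F : I -> H) (f : H) : H :=
  sum (fun i => dot f (F i) *: F i).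

End frame.

(* Main.v *)
Require Import Defs.
From HB Require Import structures.
From mathcomp Require Import all_boot all_order all_algebra finmap.
From mathcomp Require Import all_classical all_reals all_analysis.
From mathcomp Require Import measurable_realfun summability complex ring lra.

(** Write [F p] for the translate of [phi] by the lattice point [p], [V] for the
    closed span of the [F p] and [S] for the frame operator.

    Two facts give the expansion. First, [S] is a bijection of [V] and is
    self-adjoint there. Second, the lattice is a group for the Heisenberg
    law: the central component of a product, half of an imaginary part, is
    an integer because the first coordinates of the lattice points are even.
    Hence translation by [p] permutes the family [F], and as it is also
    unitary it maps [V] into itself and commutes with [S]
    ([frame_operator_symmetry]). With [phit] the inverse image of [phi] under
    [S], the translate of [phit] by [p] is therefore the inverse image of
    [F p], so that for [g] in [V] with [S g = f],
        <f, translate p phit> = <S g, translate p phit>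
                              = <g, S (translate p phit)> = <g, F p>,
    and the series to be summed is the one that defines [S g = f]
    ([frame_symmetric_dual]).

    The bijectivity of [S] comes from the two frame bounds, which say that [S]
    has norm at most [B] on [V] and that the real part of <S f, f> is at least [A] times the square of the norm of [f]. The second
    bound makes [S] injective, and the two together make
    [f - (A / B^2) S f] a contraction in [f] ([richardson_contraction]), so
    the iteration [f + (A / B^2) (g - S f)] converges to a solution of
    [S f = g] ([frame_operator_surj]).

    Both the unordered series that defines [S] and this iteration need limits
    in L2, which come from the Riesz-Fischer theorem ([L2_complete]): a fast
    Cauchy sequence converges almost everywhere, because it has bounded
    variation there, and by the lemma of Fatou the pointwise limit is also
    its limit in norm. *)

Set Implicit Arguments.
Unset Strict Implicit.
Unset Printing Implicit Defensive.

Import Order.TTheory GRing.Theory Num.Theory.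
Import numFieldNormedType.Exports.

Local Open Scope classical_set_scope.
Local Open Scope ring_scope.
Local Open Scope complex_scope.

Local Notation Re := (@complex.Re _).
Local Notation Im := (@complex.Im _).
Local Notation normc := (@Normc.normc _).
#[local] Existing Instance totally_filter.

(** * Complex numbers *)

Section complex_facts.
Context {R : realType}.
Implicit Types z w : R[i].

Lemma ReD z w : Re (z + w) = Re z + Re w.
Proof. by case: z w => ? ? []. Qed.

Lemma ImD z w : Im (z + w) = Im z + Im w.
Proof. by case: z w => ? ? []. Qed.

Lemma ReN z : Re (- z) = - Re z.
Proof. by case: z. Qed.

Lemma ReZ (a : R) z : Re (a%:C * z) = a * Re z.
Proof. by case: z => ? ? /=; rewrite mul0r subr0. Qed.

Lemma conjcD z w : conjc (z + w) = conjc z + conjc w.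
Proof. exact: rmorphD. Qed.

Lemma conjcM z w : conjc (z * w) = conjc z * conjc w.
Proof. exact: rmorphM. Qed.

Lemma conjcN z : conjc (- z) = - conjc z.
Proof. exact: rmorphN. Qed.

Lemma conjc_sum I (s : seq I) (P : pred I) (z : I -> R[i]) :
  conjc (\sum_(i <- s | P i) z i) = \sum_(i <- s | P i) conjc (z i).
Proof. exact: rmorph_sum. Qed.

Lemma Re_sum I (s : seq I) (P : pred I) (z : I -> R[i]) :
  Re (\sum_(i <- s | P i) z i) = \sum_(i <- s | P i) Re (z i).
Proof. by apply: big_morph => //; exact: ReD. Qed.

Lemma ler_Re_normc z : Re z <= normc z.
Proof.
by rewrite (le_trans (ler_norm _))// -lecR (le_trans (normc_ge_Re z))//; case: z.
Qed.

Lemma sqr_normcE z : normc z ^+ 2 = Re z * Re z + Im z * Im z.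
Proof. by case: z => a b /=; rewrite sqr_sqrtr ?addr_ge0 ?sqr_ge0// !expr2. Qed.

Lemma normc_real (x : R) : normc x%:C = `|x|.
Proof. by rewrite /= expr0n/= addr0 sqrtr_sqr. Qed.

Lemma normcJE z : normc (conjc z) = normc z.
Proof. by case: z => a b /=; rewrite sqrrN. Qed.

Lemma mulcJ_normc z : z * conjc z = (normc z ^+ 2)%:C.
Proof. by rewrite -sqr_normc; case: z => a b; rewrite rmorphXn. Qed.

End complex_facts.

(** * Norms with real values, and unordered sums *)

Section real_norm.
Context {R : realType} {H : normedModType R[i]}.
Implicit Types (u v : H).

(** On a module over the complex numbers the norm is complex valued; inequalities
    are easier to handle on its real part, which loses nothing by [rnormE]. *)
Definition rnorm u : R := Re `|u|.

Lemma rnormE u : `|u| = (rnorm u)%:C.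
Proof. by rewrite /rnorm RRe_real// ger0_real. Qed.

Lemma rnorm_ge0 u : 0 <= rnorm u.
Proof. by rewrite -ler0c -rnormE. Qed.

Lemma rnorm0 : rnorm 0 = 0.
Proof. by rewrite /rnorm normr0. Qed.

Lemma rnorm_eq0 u : rnorm u = 0 -> u = 0.
Proof. by move=> u0; apply: normr0_eq0; rewrite rnormE u0. Qed.

Lemma rnormD u v : rnorm (u + v) <= rnorm u + rnorm v.
Proof. by rewrite -lecR rmorphD/= -!rnormE ler_normD. Qed.

Lemma rnormN u : rnorm (- u) = rnorm u.
Proof. by rewrite /rnorm normrN. Qed.

Lemma rnormZ (a : R[i]) u : rnorm (a *: u) = normc a * rnorm u.
Proof. by apply: complexI; rewrite rmorphM/= -!rnormE normrZ; case: a. Qed.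

Lemma rnormB u v : rnorm (u - v) = rnorm (v - u).
Proof. by rewrite -rnormN opprB. Qed.

Lemma cvg_rnormP {T} (F : set_system T) {FF : Filter F} (f : T -> H) (l : H) :
  f @ F --> l <-> forall e : R, 0 < e -> \forall x \near F, rnorm (l - f x) < e.
Proof.
split=> [/cvgrPdist_lt fl e e0|fl].
  have /fl : 0 < e%:C by rewrite ltcR.
  by apply: filterS => x; rewrite rnormE ltcR.
(* a positive complex number has no imaginary part *)
apply/cvgrPdist_lt => -[e e'] /= /[dup]; rewrite {1}ltcE /= => /andP[/eqP -> e0] _.
by apply: filterS (fl e e0) => x; rewrite rnormE ltcR.
Qed.

Lemma cvg_totallyP (I : choiceType) (x : I -> H) (l : H) :
  partial_sum x A @[A --> totally] --> l <->
  forall e : R, 0 < e -> exists A : {fset I}, forall B : {fset I},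
    (A `<=` B)%fset -> rnorm (l - \sum_(i <- B) x i) < e.
Proof.
rewrite cvg_rnormP; split=> xl e e0.
  have [A _ AB] := xl e e0; exists A => B /AB /=.
  by rewrite /partial_sum big_seq_fsetE.
have [A AB] := xl e e0; exists A => // B /= /AB.
by rewrite /partial_sum big_seq_fsetE.
Qed.

Lemma closure_rnormP (E : set H) (f : H) :
  closure E f <-> forall e : R, 0 < e -> exists2 g, E g & rnorm (f - g) < e.
Proof.
split=> [Ef e e0|Ef B].
  have /Ef : nbhs f (ball f e%:C) by apply: nbhsx_ballx; rewrite ltcR.
  move=> [g [Eg]]; rewrite -ball_normE /ball_ /= rnormE ltcR; by exists g.
move=> /nbhs_ballP[[e e']] /= /[dup]; rewrite {1}ltcE /= => /andP[/eqP -> e0] _ fB.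
have [g Eg fg] := Ef e e0; exists g; split => //; apply: fB.
by rewrite -ball_normE /ball_ /= rnormE ltcR.
Qed.

End real_norm.

Lemma big_fsubset (V : zmodType) (I : choiceType) (A B : {fset I}) (x : I -> V) :
  (A `<=` B)%fset ->
  \sum_(i <- B) x i = \sum_(i <- A) x i + \sum_(i <- (B `\` A)%fset) x i.
Proof.
move=> AB; rewrite (big_fsetID _ (mem A))/=; congr (_ + _).
  apply: eq_fbigl => i; rewrite !inE; apply/andP/idP => [[]//|iA].
  by split => //; exact: (fsubsetP AB).
by apply: eq_fbigl => i; rewrite !inE andbC.
Qed.

(** The Cauchy criterion in terms of finite sums far out: all finite sums over
    index sets that avoid a suitable finite set are small. *)
Lemma cauchy_totally_cvg (R : realType) (H : completeNormedModType R[i])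
    (I : choiceType) (x : I -> H) :
  (forall e : R, 0 < e -> exists A : {fset I}, forall B : {fset I},
    [disjoint A & B]%fset -> rnorm (\sum_(i <- B) x i) < e) ->
  cvg (partial_sum x A @[A --> totally]).
Proof.
move=> xC; apply: cauchy_cvg; apply: cauchy_exP => -[e e'] /= /[dup].
rewrite {1}ltcE /= => /andP[/eqP -> e0] _; have [A AB] := xC e e0.
exists (\sum_(i <- A) x i); exists A => // B /= sAB.
rewrite -ball_normE /ball_ /= rnormE ltcR /partial_sum.
rewrite -(big_seq_fsetE _ B predT) (big_fsubset _ sAB) opprD addNKr rnormN.
by apply: AB; apply/fdisjointP => i iA; rewrite !inE iA.
Qed.

(** * Inner products *)

Record inner_product (R : realType) (H : normedModType R[i])
    (dot : H -> H -> R[i]) : Prop := InnerProduct {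
  dot_linearl : forall a u v w, dot (a *: u + v) w = a * dot u w + dot v w;
  dotJ : forall u v, dot v u = conjc (dot u v);
  dotvv : forall u, dot u u = (rnorm u ^+ 2)%:C }.

Section inner_product.
Context {R : realType} {H : normedModType R[i]} {dot : H -> H -> R[i]}.
Hypothesis dotP : inner_product dot.
Implicit Types (u v w : H).

Lemma dotDl u v w : dot (u + v) w = dot u w + dot v w.
Proof. by rewrite -[u]scale1r (dot_linearl dotP) mul1r scale1r. Qed.

Lemma dot0l w : dot 0 w = 0.
Proof. by apply: (addrI (dot 0 w)); rewrite -dotDl !addr0. Qed.

Lemma dotZl a u w : dot (a *: u) w = a * dot u w.
Proof. by rewrite -[a *: u]addr0 (dot_linearl dotP) dot0l addr0. Qed.

Lemma dotNl u w : dot (- u) w = - dot u w.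
Proof. by rewrite -scaleN1r dotZl mulN1r. Qed.

Lemma dotBl u v w : dot (u - v) w = dot u w - dot v w.
Proof. by rewrite dotDl dotNl. Qed.

Lemma dotDr u v w : dot u (v + w) = dot u v + dot u w.
Proof. by rewrite (dotJ dotP) dotDl conjcD -!(dotJ dotP). Qed.

Lemma dotZr a u w : dot u (a *: w) = conjc a * dot u w.
Proof. by rewrite (dotJ dotP) dotZl conjcM -(dotJ dotP). Qed.

Lemma dotNr u w : dot u (- w) = - dot u w.
Proof. by rewrite (dotJ dotP) dotNl conjcN -(dotJ dotP). Qed.

Lemma dotBr u v w : dot u (v - w) = dot u v - dot u w.
Proof. by rewrite dotDr dotNr. Qed.

Lemma dot_suml I (s : seq I) (P : pred I) (x : I -> H) w :
  dot (\sum_(i <- s | P i) x i) w = \sum_(i <- s | P i) dot (x i) w.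
Proof. by apply: (big_morph (dot^~ w)) => [u v|]; rewrite ?dotDl ?dot0l. Qed.

Lemma dot_sumr I (s : seq I) (P : pred I) (x : I -> H) w :
  dot w (\sum_(i <- s | P i) x i) = \sum_(i <- s | P i) dot w (x i).
Proof.
rewrite (dotJ dotP) dot_suml conjc_sum; apply: eq_bigr => i _.
by rewrite -(dotJ dotP).
Qed.

Lemma Re_dotvv u : Re (dot u u) = rnorm u ^+ 2.
Proof. by rewrite (dotvv dotP). Qed.

Lemma Re_dotC u v : Re (dot v u) = Re (dot u v).
Proof. by rewrite (dotJ dotP); case: (dot u v). Qed.

Lemma sqr_rnormD u v :
  rnorm (u + v) ^+ 2 = rnorm u ^+ 2 + 2 * Re (dot u v) + rnorm v ^+ 2.
Proof.
rewrite -!Re_dotvv dotDl !dotDr !ReD (Re_dotC u v); ring.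
Qed.

(** The Cauchy-Schwarz inequality: expand the nonnegative square of the norm of
    [|v|^2 u - <u, v> v]. *)
Lemma normc_dot u v : normc (dot u v) <= rnorm u * rnorm v.
Proof.
have [v0|v0] := eqVneq (rnorm v) 0.
  by rewrite (rnorm_eq0 v0) (dotJ dotP) dot0l rnorm0 mulr0 conjc0 Normc.normc0.
have v_gt0 : 0 < rnorm v by rewrite lt_def v0 rnorm_ge0.
rewrite -(@ler_pXn2r _ 2)// ?nnegrE ?normc_ge0 ?mulr_ge0 ?rnorm_ge0//.
have := sqr_ge0 (rnorm ((rnorm v ^+ 2)%:C *: u + (- dot u v) *: v)).
rewrite sqr_rnormD !rnormZ !exprMn dotZl dotZr ReZ conjcN mulNr ReN.
rewrite [conjc _ * _]mulrC mulcJ_normc normc_real (ger0_norm (sqr_ge0 _))/=.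
have -> : normc (- dot u v) = normc (dot u v) by case: (dot u v) => a b /=; rewrite !sqrrN.
move: (normc _) => d; move: (rnorm u) (rnorm v) v_gt0 => a b b0.
have -> : (b ^+ 2) ^+ 2 * a ^+ 2 + 2 * (b ^+ 2 * - d ^+ 2) + d ^+ 2 * b ^+ 2 =
  b ^+ 2 * ((a * b) ^+ 2 - d ^+ 2) by ring.
by rewrite pmulr_rge0 ?exprn_gt0// subr_ge0 exprMn.
Qed.

End inner_product.

(** The real part of [dot f g] is determined by norms, through the norm of
    [f + g]; its imaginary part is the real part of [dot (- i f) g]. *)
Lemma polarization (R : realType) (H : normedModType R[i])
    (dot : H -> H -> R[i]) (U : H -> H) : inner_product dot ->
  (forall (a : R[i]) f g, U (a *: f + g) = a *: U f + U g) ->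
  (forall f, rnorm (U f) = rnorm f) ->
  forall f g, dot (U f) (U g) = dot f g.
Proof.
move=> dotP U_lin U_iso f g.
have UD f' g' : U (f' + g') = U f' + U g' by have := U_lin 1 f' g'; rewrite !scale1r.
have U0 : U 0 = 0 by apply: (addrI (U 0)); rewrite -UD !addr0.
have UZ a f' : U (a *: f') = a *: U f' by have := U_lin a f' 0; rewrite U0 !addr0.
have Re_eq f' : Re (dot (U f') (U g)) = Re (dot f' g).
  have := sqr_rnormD dotP (U f') (U g); rewrite -UD !U_iso (sqr_rnormD dotP); lra.
have := Re_eq f; have := Re_eq ((- 'i%C) *: f); rewrite UZ !(dotZl dotP).
case: (dot (U f) _) (dot f g) => a b [c d] /=.
by rewrite !oppr0 !mul0r !sub0r !mulN1r !opprK => -> ->.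
Qed.

(** * The closed span of a family *)

Section closed_span_theory.
Context {R : realType} {H : normedModType R[i]} {I : countType}.
Variable F : I -> H.
Local Notation V := (closed_span F).
Local Notation span := [set f | exists (A : {fset I}) (c : I -> R[i]),
  f = \sum_(i <- A) c i *: F i].

(** Two finite combinations are first extended by zero to the union of their
    supports. *)
Lemma spanZD (a : R[i]) f g : span f -> span g -> span (a *: f + g).
Proof.
move=> [A [c ->]] [B [d ->]].
pose x (C : {fset I}) (e : I -> R[i]) i := (if i \in C then e i else 0) *: F i.
have xE (C : {fset I}) e : (C `<=` A `|` B)%fset ->
    \sum_(i <- C) e i *: F i = \sum_(i <- (A `|` B)%fset) x C e i.
  move=> CAB; rewrite -[RHS](big_fset_incl _ CAB).
    by apply: eq_fbigr => i iC _; rewrite /x iC.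
  by move=> i _; rewrite /x => /negPf ->; rewrite scale0r.
exists (A `|` B)%fset; exists (fun i =>
  a * (if i \in A then c i else 0) + (if i \in B then d i else 0)).
rewrite (xE A c) ?fsubsetUl// (xE B d) ?fsubsetUr// scaler_sumr -big_split/=.
by apply: eq_bigr => i _; rewrite /x scalerA -scalerDl.
Qed.

Lemma closed_spanZD (a : R[i]) f g : V f -> V g -> V (a *: f + g).
Proof.
move=> /closure_rnormP Vf /closure_rnormP Vg; apply/closure_rnormP => e e0.
have a0 : 0 < normc a + 1 by rewrite ltr_wpDl// normc_ge0.
have [|f' Ef' ff'] := Vf (e / 2 / (normc a + 1)); first by rewrite !divr_gt0.
have [|g' Eg' gg'] := Vg (e / 2); first by rewrite divr_gt0.
exists (a *: f' + g'); first exact: spanZD.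
rewrite opprD addrACA -scalerBr (le_lt_trans (rnormD _ _))// rnormZ.
rewrite [ltRHS]splitr ler_ltD// (@le_trans _ _ ((normc a + 1) * rnorm (f - f')))//.
  by rewrite ler_wpM2r ?rnorm_ge0// lerDl.
by rewrite mulrC -ler_pdivlMr// ltW.
Qed.

Lemma closed_span_gen i : V (F i).
Proof.
apply: subset_closure; exists [fset i]%fset; exists (fun=> 1).
by rewrite big_seq_fset1 scale1r.
Qed.

Lemma closed_span0 : V 0.
Proof.
by apply: subset_closure; exists fset0; exists (fun=> 0); rewrite big_seq_fset0.
Qed.

Lemma closed_spanZ (a : R[i]) f : V f -> V (a *: f).
Proof. by move=> Vf; rewrite -[_ *: _]addr0; apply: closed_spanZD => //; exact: closed_span0. Qed.

Lemma closed_spanD f g : V f -> V g -> V (f + g).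
Proof. by move=> Vf; rewrite -[f]scale1r; exact: closed_spanZD. Qed.

Lemma closed_spanB f g : V f -> V g -> V (f - g).
Proof. by move=> Vf Vg; rewrite addrC -scaleN1r; exact: closed_spanZD. Qed.

Lemma closed_span_sum (J : Type) (s : seq J) (P : pred J) (x : J -> H) :
  (forall j, P j -> V (x j)) -> V (\sum_(j <- s | P j) x j).
Proof. by apply: big_ind; [exact: closed_span0|exact: closed_spanD]. Qed.

Lemma closed_span_lim f :
  (forall e : R, 0 < e -> exists2 g, V g & rnorm (f - g) < e) -> V f.
Proof.
move=> /closure_rnormP.
by have /closure_id <- := @closed_closure _ (span : set H).
Qed.

End closed_span_theory.

(** * Frames *)

Section esum_fset.
Context {R : realType} {I : choiceType} (a : I -> R).
Hypothesis a0 : forall i, 0 <= a i.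

Lemma le_fset_esum (M : R) (J : {fset I}) :
  (\esum_(i in [set: I]) (a i)%:E <= M%:E)%E -> \sum_(i <- J) a i <= M.
Proof.
rewrite -lee_fin; apply: le_trans; apply: esum_ge; exists [set` J] => //.
by rewrite fsbig_finite//= set_fsetK sumEFin.
Qed.

Lemma esum_ge_fset (M e : R) : (M%:E <= \esum_(i in [set: I]) (a i)%:E)%E ->
  0 < e -> exists J : {fset I}, M - e < \sum_(i <- J) a i.
Proof.
move=> Ma e0; have : ((M - e)%:E < \esum_(i in [set: I]) (a i)%:E)%E.
  by apply: lt_le_trans Ma; rewrite lte_fin ltrBlDr ltrDl.
move=> /ereal_sup_gt[_ [X [finX _] <-]] Me; exists (fset_set X).
by rewrite -lte_fin -sumEFin -fsbig_finite.
Qed.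

End esum_fset.

Section frame_theory.
Context {R : realType} {H : completeNormedModType R[i]} {I : countType}.
Variables (dot : H -> H -> R[i]) (F : I -> H) (A B : R).
Hypothesis dotP : inner_product dot.
Local Notation V := (closed_span F).
Local Notation S := (frame_operator dot F).
Hypotheses (A0 : 0 < A) (B0 : 0 < B).
Hypothesis frame_le : forall f, V f -> forall J : {fset I},
  \sum_(i <- J) normc (dot f (F i)) ^+ 2 <= B * rnorm f ^+ 2.
Hypothesis frame_ge : forall f, V f -> forall e : R, 0 < e ->
  exists J : {fset I}, A * rnorm f ^+ 2 - e < \sum_(i <- J) normc (dot f (F i)) ^+ 2.

(** The synthesis operator is the adjoint of the analysis operator, so it obeys
    the same upper bound. With [g] the finite sum, [|g|^2] is the sum of the
    [c i <F i, g>]; the inequality of the means weighted by [B] gives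
    [2 B |g|^2 <= B^2 sum |c i|^2 + B |g|^2]. *)
Lemma synthesis_le (c : I -> R[i]) (J : {fset I}) :
  rnorm (\sum_(i <- J) c i *: F i) ^+ 2 <= B * \sum_(i <- J) normc (c i) ^+ 2.
Proof.
set g := \sum_(i <- J) _.
have Vg : V g by apply: closed_span_sum => i _; apply/closed_spanZ/closed_span_gen.
suff : 2 * B * rnorm g ^+ 2 <=
    B ^+ 2 * \sum_(i <- J) normc (c i) ^+ 2 + B * rnorm g ^+ 2.
  by move=> h; rewrite -(ler_pM2l B0); lra.
apply: (@le_trans _ _ (B ^+ 2 * \sum_(i <- J) normc (c i) ^+ 2 +
    \sum_(i <- J) normc (dot g (F i)) ^+ 2)); last by rewrite lerD2l frame_le.
rewrite -(Re_dotvv dotP) {1}/g (dot_suml dotP) Re_sum !mulr_sumr -big_split/=.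
apply: ler_sum => i _; rewrite (dotZl dotP) (dotJ dotP g).
apply: (@le_trans _ _ (2 * B * (normc (c i) * normc (dot g (F i))))).
  rewrite ler_pM2l ?mulr_gt0// -(normcJE (dot g _)) -Normc.normcM.
  exact: ler_Re_normc.
have := sqr_ge0 (B * normc (c i) - normc (dot g (F i))); lra.
Qed.

(** By [synthesis_le], the partial sums are Cauchy as soon as the coefficients
    are square summable: a finite set of indices whose sum of squares nearly
    reaches the supremum leaves little for the indices outside. *)
Lemma synthesis_cvg (c : I -> R[i]) (M : R) :
  (forall J : {fset I}, \sum_(i <- J) normc (c i) ^+ 2 <= M) ->
  cvg (partial_sum (fun i => c i *: F i) J @[J --> totally]).
Proof.
move=> cM; apply: cauchy_totally_cvg => e e0.
pose E := [set \sum_(i <- J) normc (c i) ^+ 2 | J in [set: {fset I}]].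
have supE : has_sup E.
  split; first by exists (\sum_(i <- fset0) normc (c i) ^+ 2); exists fset0.
  by exists M => _ [J _ <-]; exact: cM.
(* [synthesis_le] turns the margin [e^2 / B] into a norm below [e] *)
have [|_ [J _ <-] supJ] := @sup_adherent _ E (e ^+ 2 / B) _ supE.
  by rewrite divr_gt0 ?exprn_gt0.
exists J => K JK; rewrite -(@ltr_pXn2r _ 2)// ?nnegrE ?rnorm_ge0 ?(ltW e0)//.
apply: le_lt_trans (synthesis_le c K) _; rewrite mulrC -ltr_pdivlMr//.
rewrite -(ltrD2l (\sum_(i <- J) normc (c i) ^+ 2)).
rewrite ltrBlDr in supJ; apply: le_lt_trans supJ; apply: sup_ubound => //.
  by case: supE.
exists (J `|` K)%fset => //; rewrite (big_fsubset _ (fsubsetUl J K)); congr (_ + _).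
apply: eq_fbigl => i; rewrite !inE; case: (boolP (i \in J)) => //= iJ.
by apply/esym/negbTE; exact: (fdisjointP JK).
Qed.

Lemma frame_operatorE f : V f ->
  partial_sum (fun i => dot f (F i) *: F i) J @[J --> totally] --> S f.
Proof. by move=> Vf; apply: synthesis_cvg => J; exact: frame_le. Qed.

Lemma frame_operator_approx f (e : R) : V f -> 0 < e -> exists J : {fset I},
  forall K : {fset I}, (J `<=` K)%fset ->
    rnorm (S f - \sum_(i <- K) dot f (F i) *: F i) < e.
Proof. by move=> /frame_operatorE/cvg_totallyP; exact. Qed.

Lemma frame_operator_closed f : V f -> V (S f).
Proof.
move=> Vf; apply: closed_span_lim => e /(frame_operator_approx Vf)[J SJ].
exists (\sum_(i <- J) dot f (F i) *: F i); last exact: SJ.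
by apply: closed_span_sum => i _; apply/closed_spanZ/closed_span_gen.
Qed.

Lemma frame_operatorZD (a : R[i]) f g : V f -> V g ->
  S (a *: f + g) = a *: S f + S g.
Proof.
move=> Vf Vg; apply: norm_cvg_lim.
rewrite (_ : partial_sum _ = fun J =>
  a *: partial_sum (fun i => dot f (F i) *: F i) J +
  partial_sum (fun i => dot g (F i) *: F i) J); last first.
  apply/funext => J; rewrite /partial_sum scaler_sumr -big_split/=.
  by apply: eq_bigr => i _; rewrite (dot_linearl dotP) scalerDl scalerA.
by apply: cvgD; [apply: cvgZl_tmp|]; exact: frame_operatorE.
Qed.

Lemma frame_operatorB f g : V f -> V g -> S (f - g) = S f - S g.
Proof.
move=> Vf Vg; rewrite addrC -scaleN1r frame_operatorZD// scaleN1r addrC.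
by [].
Qed.

Lemma rnorm_frame_operator f : V f -> rnorm (S f) <= B * rnorm f.
Proof.
move=> Vf; apply/ler_addgt0Pr => e e0; have [J SJ] := frame_operator_approx Vf e0.
have := SJ J (fsubset_refl _); set g := \sum_(i <- J) _ => Sg.
rewrite -(subrK g (S f)) (le_trans (rnormD _ _))// addrC lerD//; last exact: ltW.
rewrite -(@ler_pXn2r _ 2)// ?nnegrE ?mulr_ge0 ?rnorm_ge0 ?(ltW B0)//.
apply: (le_trans (synthesis_le (fun i => dot f (F i)) J)).
by rewrite exprMn expr2 -mulrA ler_pM2l// frame_le.
Qed.

Lemma frame_operator_ge f : V f -> A * rnorm f ^+ 2 <= Re (dot (S f) f).
Proof.
move=> Vf; apply/ler_addgt0Pr => e e0.
have e1 : 0 < e / 2 / (rnorm f + 1) by rewrite !divr_gt0// ltr_wpDl ?rnorm_ge0.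
have [J SJ] := frame_operator_approx Vf e1.
have [K AK] := frame_ge Vf (divr_gt0 e0 (ltr0n R 2)).
have {SJ} := SJ (J `|` K)%fset (fsubsetUl _ _); set g := \sum_(i <- _) _ => Sg.
have fg : A * rnorm f ^+ 2 - e / 2 < Re (dot g f).
  apply: (lt_le_trans AK); rewrite (dot_suml dotP) Re_sum.
  have gE i : Re (dot (dot f (F i) *: F i) f) = normc (dot f (F i)) ^+ 2.
    by rewrite (dotZl dotP) (dotJ dotP f (F i)) mulcJ_normc.
  under [leRHS]eq_bigr do rewrite gE.
  rewrite (big_fsubset _ (fsubsetUr J K)) lerDl.
  by apply: sumr_ge0 => i _; exact: sqr_ge0.
have Sgf : Re (dot (g - S f) f) <= e / 2.
  apply: (le_trans (ler_Re_normc _)); apply: (le_trans (normc_dot dotP _ _)).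
  rewrite rnormB (le_trans (ler_wpM2r (rnorm_ge0 f) (ltW Sg)))//.
  rewrite -[leLHS]mulrA ler_piMr ?divr_ge0 ?ltW// mulrC ltr_pdivrMr.
    by rewrite mul1r ltrDl.
  by rewrite ltr_wpDl ?rnorm_ge0.
move: Sgf; rewrite (dotBl dotP) ReD ReN; lra.
Qed.

(** For the partial sums of [S f] and [S g] over a common finite set the identity
    is the hermitian symmetry of [dot]; the errors are controlled by
    Cauchy-Schwarz. *)
Lemma frame_operator_selfadjoint f g : V f -> V g -> dot (S f) g = dot f (S g).
Proof.
move=> Vf Vg; apply/eqP; rewrite -subr_eq0; apply/eqP/Normc.eq0_normc.
apply/eqP; rewrite eq_le normc_ge0 andbT; apply/ler_addgt0Pr => e e0; rewrite add0r.
have c0 : 0 < rnorm f + rnorm g + 1 by rewrite ltr_wpDl// addr_ge0 ?rnorm_ge0.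
have e1 : 0 < e / (rnorm f + rnorm g + 1) by rewrite divr_gt0.
have [J SJ] := frame_operator_approx Vf e1.
have [K SK] := frame_operator_approx Vg e1.
move: SJ SK => /(_ (J `|` K)%fset (fsubsetUl _ _)) + /(_ (J `|` K)%fset (fsubsetUr _ _)).
set f' := \sum_(i <- _) _ => ff'; set g' := \sum_(i <- _) _ => gg'.
have f'g' : dot f' g = dot f g'.
  rewrite (dot_suml dotP) (dot_sumr dotP); apply: eq_bigr => i _.
  by rewrite (dotZl dotP) (dotZr dotP) -(dotJ dotP) mulrC.
have -> : dot (S f) g - dot f (S g) = dot (S f - f') g + dot f (g' - S g).
  by rewrite (dotBl dotP) (dotBr dotP) f'g' addrA subrK.
apply: (le_trans (le_normcD _ _)).
apply: (@le_trans _ _ (rnorm (S f - f') * rnorm g + rnorm f * rnorm (S g - g'))).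
  by rewrite (rnormB (S g)) lerD// normc_dot.
move: ff' gg' => /ltW ff' /ltW gg'.
apply: (le_trans (lerD (ler_wpM2r (rnorm_ge0 g) ff') (ler_wpM2l (rnorm_ge0 f) gg'))).
rewrite [in leLHS]mulrC -mulrDl addrC mulrA ler_pdivrMr// mulrC ler_pM2l//.
by lra.
Qed.

Lemma frame_operator_bounded_below f : V f -> A * rnorm f <= rnorm (S f).
Proof.
move=> Vf; have [f0|f0] := eqVneq (rnorm f) 0; first by rewrite f0 mulr0 rnorm_ge0.
have {}f0 : 0 < rnorm f by rewrite lt_def f0 rnorm_ge0.
rewrite -(ler_pM2r f0) -mulrA -expr2 (le_trans (frame_operator_ge Vf))//.
by rewrite (le_trans (ler_Re_normc _))// normc_dot.
Qed.

Lemma frame_operator_inj f g : V f -> V g -> S f = S g -> f = g.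
Proof.
move=> Vf Vg Sfg; apply/eqP; rewrite -subr_eq0; apply/eqP/rnorm_eq0/eqP.
have := frame_operator_bounded_below (closed_spanB Vf Vg).
rewrite frame_operatorB// Sfg subrr rnorm0 pmulr_rle0// => h.
by rewrite eq_le h rnorm_ge0.
Qed.

(** Expanding the square of the left-hand norm with [t := A / B^2] gives at most
    [(1 - 2 t A + t^2 B^2) |f|^2], and [t] minimises this factor, whose value is
    then [1 - A^2 / B^2]. If that number is negative then [f] is zero, and the
    square root, zero by convention, still gives a true bound. *)
Lemma richardson_contraction f : V f ->
  rnorm (f - (A / B ^+ 2)%:C *: S f) <=
    Num.sqrt (1 - A ^+ 2 / B ^+ 2) * rnorm f.
Proof.
move=> Vf; set t := A / B ^+ 2.
have t0 : 0 < t by rewrite divr_gt0 ?exprn_gt0.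
rewrite mulrC -[X in X * _]ger0_norm ?rnorm_ge0// -sqrtr_sqr -sqrtrM ?sqr_ge0//.
rewrite -[leLHS]ger0_norm ?rnorm_ge0// -sqrtr_sqr ler_wsqrtr//.
rewrite (sqr_rnormD dotP) rnormN rnormZ normc_real (ger0_norm (ltW t0)).
rewrite (dotNr dotP) (dotZr dotP) conjc_real ReN ReZ (Re_dotC dotP).
have h1 := frame_operator_ge Vf.
have h2 : rnorm (S f) ^+ 2 <= B ^+ 2 * rnorm f ^+ 2.
  rewrite -exprMn ler_pXn2r ?nnegrE ?mulr_ge0 ?rnorm_ge0 ?(ltW B0)//.
  exact: rnorm_frame_operator.
have tB : t * B ^+ 2 = A by rewrite mulfVK// expf_neq0// gt_eqF.
have -> : A ^+ 2 / B ^+ 2 = t * A by rewrite expr2 -mulrA mulrC.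
move: h1 h2; move: (rnorm (S f)) (rnorm f) (Re _) => s x d h1 h2.
clearbody t; have {}h1 : 0 <= t * (d - A * x ^+ 2).
  by apply: mulr_ge0; [exact: ltW|rewrite subr_ge0].
have {h2} : 0 <= t ^+ 2 * (B ^+ 2 * x ^+ 2 - s ^+ 2).
  by rewrite mulr_ge0 ?subr_ge0// sqr_ge0.
have -> : t ^+ 2 * (B ^+ 2 * x ^+ 2 - s ^+ 2) =
  t * (t * B ^+ 2) * x ^+ 2 - t ^+ 2 * s ^+ 2 by ring.
rewrite tB exprMn; move: h1; move: (t ^+ 2 * _) => w; lra.
Qed.

(** Richardson iteration. The residual [g - S (f_ n)] decays geometrically, and
    since [S] is bounded below, distances between iterates are controlled by
    their residuals; so the iterates are Cauchy. *)
Lemma frame_operator_surj g : V g -> exists2 f, V f & S f = g.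
Proof.
move=> Vg; set q := Num.sqrt (1 - A ^+ 2 / B ^+ 2).
have q0 : 0 <= q by exact: sqrtr_ge0.
have q1 : q < 1.
  rewrite /q -[ltRHS]sqrtr1 ltr_sqrt// gtrDl oppr_lt0.
  by rewrite divr_gt0 ?exprn_gt0.
pose step f := f + (A / B ^+ 2)%:C *: (g - S f).
pose f_ n := iter n step 0.
have Vf n : V (f_ n).
  elim: n => [|n IH]; first exact: closed_span0.
  apply: closed_spanD => //; apply/closed_spanZ/closed_spanB => //.
  exact: frame_operator_closed.
have res n : rnorm (g - S (f_ n)) <= q ^+ n * rnorm g.
  elim: n => [|n IH].
    rewrite /f_/= mul1r (_ : S 0 = 0) ?subr0//.
    by rewrite -(subrr g) frame_operatorB// !subrr.
  have Vr : V (g - S (f_ n)) by apply: closed_spanB => //; exact: frame_operator_closed.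
  have -> : g - S (f_ n.+1) = (g - S (f_ n)) - (A / B ^+ 2)%:C *: S (g - S (f_ n)).
    by rewrite /f_ iterS -/(f_ n) /step [f_ n + _]addrC frame_operatorZD// opprD addrA addrAC.
  apply: (le_trans (richardson_contraction Vr)).
  by rewrite -/q exprS -mulrA ler_wpM2l.
have res_small (e : R) : 0 < e -> exists n, forall m, (n <= m)%N ->
    rnorm (g - S (f_ m)) < e.
  move=> e0; have e1 : 0 < e / (rnorm g + 1).
    by rewrite divr_gt0// ltr_wpDl ?rnorm_ge0.
  have : q ^+ n @[n --> \oo] --> (0 : R) by apply: cvg_expr; rewrite ger0_norm.
  move=> /cvgrPdist_lt/(_ _ e1)[n _ qn]; exists n => m nm.
  apply: (le_lt_trans (res m)).
  have := qn m nm; rewrite /= sub0r normrN ger0_norm ?exprn_ge0//.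
  rewrite ltr_pdivlMr ?ltr_wpDl ?rnorm_ge0//; apply: le_lt_trans.
  by rewrite ler_wpM2l ?exprn_ge0// lerDl.
have : cvg (f_ n @[n --> \oo]).
  apply: cauchy_cvg; apply: cauchy_exP => -[e e'] /= /[dup].
  rewrite {1}ltcE /= => /andP[/eqP -> e0] _.
  have [n rn] := res_small (A * e / 2) (divr_gt0 (mulr_gt0 A0 e0) (ltr0n _ 2)).
  exists (f_ n); exists n => // m /= nm.
  rewrite -ball_normE /ball_ /= rnormE ltcR -(ltr_pM2l A0).
  apply: (le_lt_trans (frame_operator_bounded_below (closed_spanB (Vf n) (Vf m)))).
  rewrite frame_operatorB// -(subrKA g) addrC (le_lt_trans (rnormD _ _))//.
  by rewrite [ltRHS]splitr ltrD// ?rn// rnormB rn.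
move=> /cvg_ex[f /cvg_rnormP ff].
have Vlim : V f.
  apply: closed_span_lim => e /ff[n _ fn]; exists (f_ n) => //.
  exact: (fn n (leqnn n)).
exists f => //; apply/eqP; rewrite -subr_eq0; apply/eqP/rnorm_eq0/eqP.
rewrite eq_le rnorm_ge0 andbT; apply/ler_addgt0Pr => e e0; rewrite add0r.
have e2 : 0 < e / 2 by rewrite divr_gt0.
have [n rn] := res_small _ e2.
have [m _ fm] := ff _ (divr_gt0 e2 B0).
have {}rn := rn (maxn n m) (leq_maxl _ _).
have {}fm := fm (maxn n m) (leq_maxr _ _).
rewrite -(subrKA (S (f_ (maxn n m)))) -frame_operatorB// (le_trans (rnormD _ _))//.
rewrite [leRHS]splitr lerD//; last by rewrite rnormB ltW.
apply: (le_trans (rnorm_frame_operator (closed_spanB _ _))) => //.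
by rewrite mulrC -ler_pdivlMr// ltW.
Qed.

Lemma frame_operator_bij : set_bij V V S.
Proof.
split; first by move=> f Vf; exact: frame_operator_closed.
- by move=> f g; rewrite !inE; exact: frame_operator_inj.
- by move=> g /frame_operator_surj[f Vf <-]; exists f.
Qed.

Section symmetry.
Variables (U : H -> H) (s s' : I -> I).
Hypotheses (sK : cancel s s') (s'K : cancel s' s).
Hypothesis U_linear : forall (a : R[i]) f g, U (a *: f + g) = a *: U f + U g.
Hypothesis U_dot : forall f g, dot (U f) (U g) = dot f g.
Hypothesis UF : forall i, U (F i) = F (s i).

Lemma symmetry_sum (J : {fset I}) (c : I -> R[i]) :
  U (\sum_(i <- J) c i *: F i) = \sum_(i <- J) c i *: F (s i).
Proof.
have U0 : U 0 = 0.
  by have := U_linear (-1) 0 0; rewrite scaler0 addr0 scaleN1r addNr.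
elim/big_rec2: _ => // i x y _ <-.
by rewrite U_linear UF.
Qed.

Lemma symmetryB f g : U (f - g) = U f - U g.
Proof. by rewrite addrC -scaleN1r U_linear scaleN1r addrC. Qed.

Lemma rnorm_symmetry f : rnorm (U f) = rnorm f.
Proof.
apply/eqP; rewrite -(@eqrXn2 _ 2)// ?rnorm_ge0//; apply/eqP.
by rewrite -!(Re_dotvv dotP) U_dot.
Qed.

Lemma symmetry_closed f : V f -> V (U f).
Proof.
move=> /closure_rnormP Vf; apply: closed_span_lim => e /Vf[_ [J [c ->]] fg].
exists (U (\sum_(i <- J) c i *: F i)); last by rewrite -symmetryB rnorm_symmetry.
by rewrite symmetry_sum; apply: closed_span_sum => i _; apply/closed_spanZ/closed_span_gen.
Qed.

(** A linear isometry that permutes the frame only reindexes the series of [S];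
    [L] below is large enough for [S f], and so is its image [sL] for
    [S (U f)]. *)
Lemma frame_operator_symmetry f : V f -> S (U f) = U (S f).
Proof.
move=> Vf; apply/eqP; rewrite -subr_eq0; apply/eqP/rnorm_eq0/eqP.
rewrite eq_le rnorm_ge0 andbT; apply/ler_addgt0Pr => e e0; rewrite add0r.
have e2 : 0 < e / 2 by rewrite divr_gt0.
have [J SJ] := frame_operator_approx Vf e2.
have [K SK] := frame_operator_approx (symmetry_closed Vf) e2.
pose L := (J `|` [fset s' i | i in K])%fset.
pose sL := [fset s i | i in L]%fset.
have {}SJ := SJ L (fsubsetUl _ _).
have {SK} : rnorm (S (U f) - \sum_(i <- sL) dot (U f) (F i) *: F i) < e / 2.
  apply: SK; apply/fsubsetP => i iK; apply/imfsetP; exists (s' i); last by rewrite s'K.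
  by rewrite !inE in_imfset ?orbT.
rewrite big_imfset/=; last by move=> i j _ _; exact: can_inj sK i j.
rewrite (eq_bigr (fun i => dot f (F i) *: F (s i))); last first.
  by move=> i _; rewrite -UF U_dot.
rewrite -symmetry_sum => SK; rewrite -(subrKA (U (\sum_(i <- L) dot f (F i) *: F i))).
rewrite (le_trans (rnormD _ _))// [leRHS]splitr lerD ?(ltW SK)//.
by rewrite -symmetryB rnorm_symmetry rnormB ltW.
Qed.

End symmetry.

(** For a frame that is the orbit of one vector under linear isometries
    that permute it, the canonical dual frame is the orbit of the dual vector. *)
Lemma frame_symmetric_dual (U : I -> H -> H) (s s' : I -> I -> I) (phi phit : H) :
  (forall p, cancel (s p) (s' p)) -> (forall p, cancel (s' p) (s p)) ->
  (forall p (a : R[i]) f g, U p (a *: f + g) = a *: U p f + U p g) ->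
  (forall p f g, dot (U p f) (U p g) = dot f g) ->
  (forall p i, U p (F i) = F (s p i)) ->
  (forall p, F p = U p phi) ->
  V phit -> S phit = phi ->
  forall f, V f ->
    partial_sum (fun p => dot f (U p phit) *: F p) J @[J --> totally] --> f.
Proof.
move=> sK s'K U_lin U_dot UF Fphi Vphit Sphit f Vf.
have [g Vg Sgf] := frame_operator_surj Vf.
rewrite -{2}Sgf.
rewrite (_ : (fun p => _) = fun p => dot g (F p) *: F p); first exact: frame_operatorE.
apply/funext => p; congr (_ *: _).
have VU := symmetry_closed (U_lin p) (U_dot p) (UF p) Vphit.
rewrite -Sgf (frame_operator_selfadjoint Vg VU).
by rewrite (frame_operator_symmetry (sK p) (s'K p) (U_lin p) (U_dot p) (UF p))// Sphit Fphi.
Qed.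

End frame_theory.

Lemma is_frame_bounds (R : realType) (H : normedModType R[i]) (I : countType)
    (dot : H -> H -> R[i]) (V : set H) (F : I -> H) :
  is_frame dot V F -> exists A B : R, [/\ 0 < A, 0 < B,
    forall f, V f -> forall J : {fset I},
      \sum_(i <- J) normc (dot f (F i)) ^+ 2 <= B * rnorm f ^+ 2 &
    forall f, V f -> forall e : R, 0 < e -> exists J : {fset I},
      A * rnorm f ^+ 2 - e < \sum_(i <- J) normc (dot f (F i)) ^+ 2].
Proof.
move=> [_ [A [B [A0 B0 AB]]]]; exists A, B; split=> // f /AB/andP[fA fB].
  by move=> J; apply: le_fset_esum fB => i; exact: sqr_ge0.
by move=> e e0; apply: esum_ge_fset fA e0.
Qed.

(** * The inner product of L2 *)

Section L2dot_theory.
Context {d} {T : measurableType d} {R : realType}.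
Variable mu : {measure set T -> \bar R}.
Implicit Types (f g : T -> R[i]) (u v w : L2 mu).
Local Open Scope quotient_scope.

Local Notation E p q := (\int[mu]_x (p x * q x)).

Lemma Lfun2_normc f (p : T -> R) : f \in L2pred mu -> measurable_fun setT p ->
  (forall x, `|p x| <= normc (f x)) -> p \in Lfun mu 2%:E.
Proof.
move=> fL mp pf; rewrite inE; apply/andP; split; rewrite inE//=.
have := L2predP fL; rewrite inE => /andP[_]; rewrite inE /= => /(le_lt_trans _); apply.
apply: le_Lnorm2 => //.
  by move: fL; rewrite inE => -[mr mi _]; exact: measurable_normc.
by apply/aeW => x; exact: le_trans (pf x) (ler_norm _).
Qed.

Lemma Lfun2_Re (f : T -> R[i]) : f \in L2pred mu -> Re \o f \in Lfun mu 2%:E.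
Proof.
move=> fL; apply: (Lfun2_normc fL).
  by move: fL; rewrite inE => -[].
by move=> x /=; rewrite -lecR (le_trans (normc_ge_Re _))//; case: (f x).
Qed.

Lemma Lfun2_Im (f : T -> R[i]) : f \in L2pred mu -> Im \o f \in Lfun mu 2%:E.
Proof.
move=> fL; apply: (Lfun2_normc fL).
  by move: fL; rewrite inE => -[].
move=> x /=; case: (f x) => a b /=.
by rewrite -sqrtr_sqr ler_wsqrtr// lerDr sqr_ge0.
Qed.

Lemma integrable_mul (p q : T -> R) : p \in Lfun mu 2%:E -> q \in Lfun mu 2%:E ->
  mu.-integrable setT (EFin \o (fun x => p x * q x)).
Proof. by move=> pL qL; apply/Lfun1_integrable; exact: Lfun2_mul_Lfun1. Qed.

Lemma Rintegral_mulDl (p1 p2 p3 q : T -> R) (a b : R) :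
  p1 \in Lfun mu 2%:E -> p2 \in Lfun mu 2%:E -> p3 \in Lfun mu 2%:E ->
  q \in Lfun mu 2%:E ->
  \int[mu]_x ((a * p1 x + b * p2 x + p3 x) * q x) =
  a * E p1 q + b * E p2 q + E p3 q.
Proof.
move=> p1L p2L p3L qL.
have i1 := integrable_mul p1L qL; have i2 := integrable_mul p2L qL.
have i3 := integrable_mul p3L qL.
have ia1 : mu.-integrable setT (EFin \o (fun x => a * (p1 x * q x))) by exact: (integrableZl measurableT a i1).
have ib2 : mu.-integrable setT (EFin \o (fun x => b * (p2 x * q x))) by exact: (integrableZl measurableT b i2).
rewrite -!RintegralZl// -!RintegralD//; last exact: (integrableD measurableT ia1 ib2).
by apply: eq_Rintegral => x _; rewrite !mulrDl !mulrA.
Qed.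

Lemma eq_ae_Rintegral_mul (p p' q q' : T -> R) :
  measurable_fun setT p -> measurable_fun setT p' ->
  measurable_fun setT q -> measurable_fun setT q' ->
  (\forall x \ae mu, p x = p' x) -> (\forall x \ae mu, q x = q' x) ->
  E p q = E p' q'.
Proof.
move=> mp mp' mq mq' pp' qq'; congr fine; apply: ae_eq_integral => //.
- by apply/measurable_EFinP; exact: measurable_funM.
- by apply/measurable_EFinP; exact: measurable_funM.
- by apply: filterS2 pp' qq' => x -> ->.
Qed.

Lemma L2dotE (f g : L2fun mu) :
  L2dot (\pi_(L2 mu) f) (\pi_(L2 mu) g) =
    (E (Re \o f) (Re \o g) + E (Im \o f) (Im \o g)) +i*
    (E (Im \o f) (Re \o g) - E (Re \o f) (Im \o g)).
Proof.
have reE (h : L2fun mu) (op : R[i] -> R) :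
    \forall x \ae mu, (op \o repr (\pi_(L2 mu) h)) x = (op \o h) x.
  by apply: filterS (L2_reprP h) => x /= ->.
have mR (h : L2fun mu) : measurable_fun setT (Re \o h).
  by have := valP h; rewrite inE => -[].
have mI (h : L2fun mu) : measurable_fun setT (Im \o h).
  by have := valP h; rewrite inE => -[].
rewrite -(eq_ae_Rintegral_mul _ _ _ _ (reE f Re) (reE g Re))//.
rewrite -(eq_ae_Rintegral_mul _ _ _ _ (reE f Im) (reE g Im))//.
rewrite -(eq_ae_Rintegral_mul _ _ _ _ (reE f Im) (reE g Re))//.
rewrite -(eq_ae_Rintegral_mul _ _ _ _ (reE f Re) (reE g Im))//.
rewrite /L2dot; move: (repr (\pi_(L2 mu) f)) (repr (\pi_(L2 mu) g)) => {}f {}g.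
have fR := Lfun2_Re (valP f); have fI := Lfun2_Im (valP f).
have gR := Lfun2_Re (valP g); have gI := Lfun2_Im (valP g).
rewrite -RintegralD//; [|exact: integrable_mul..].
rewrite -RintegralB//; [|exact: integrable_mul..].
congr Complex; apply: eq_Rintegral => x _ /=.
  by case: (f x) (g x) => a b [c e] /=; rewrite mulrN opprK.
by case: (f x) (g x) => a b [c e] /=; rewrite mulrN addrC.
Qed.

Lemma sqr_L2norm (f : L2fun mu) :
  ((L2norm (\pi_(L2 mu) f)) ^+ 2)%:E =
  (\int[mu]_x ((normc (f x)) ^+ 2)%:E)%E.
Proof.
rewrite -powR_mulrn ?fine_ge0 ?Lnorm_ge0// -poweR_EFin pi_L2normE poweR_Lnorm//.
apply: eq_integral => x _ /=.
by rewrite powR_mulrn// ger0_norm// normc_ge0.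
Qed.

Lemma L2dot_inner_product : inner_product (@L2dot _ _ _ mu).
Proof.
split=> [a u v w|u v|u].
- rewrite -[u]reprK -[v]reprK -[w]reprK -[a *: _]/(L2scale a _) pi_L2scale -raddfD/=.
  move: (repr u) (repr v) (repr w) => f g h; rewrite !L2dotE.
  have fR := Lfun2_Re (valP f); have fI := Lfun2_Im (valP f).
  have gR := Lfun2_Re (valP g); have gI := Lfun2_Im (valP g).
  have hR := Lfun2_Re (valP h); have hI := Lfun2_Im (valP h).
  have EReD (q : T -> R) : q \in Lfun mu 2%:E -> E (Re \o (a *: f + g : L2fun mu)) q =
      Re a * E (Re \o f) q + - Im a * E (Im \o f) q + E (Re \o g) q.
    move=> qL; rewrite -Rintegral_mulDl//; apply: eq_Rintegral => x _ /=.
    by rewrite !fctE; case: (a) (f x) (g x) => ? ? [? ?] [? ?] /=; rewrite mulNr.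
  have EImD (q : T -> R) : q \in Lfun mu 2%:E -> E (Im \o (a *: f + g : L2fun mu)) q =
      Im a * E (Re \o f) q + Re a * E (Im \o f) q + E (Im \o g) q.
    move=> qL; rewrite -Rintegral_mulDl//; apply: eq_Rintegral => x _ /=.
    by rewrite !fctE; case: (a) (f x) (g x) => ? ? [? ?] [? ?] /=; congr (_ * _); ring.
  rewrite !EReD// !EImD//; case: a {EReD EImD} => a b /=.
  by congr Complex; ring.
- rewrite -[u]reprK -[v]reprK; move: (repr u) (repr v) => f g; rewrite !L2dotE.
  have EC (p q : T -> R) : E p q = E q p by apply: eq_Rintegral => x _; rewrite mulrC.
  by rewrite /= opprB; congr (Complex (_ + _) (_ - _)); exact: EC.
- rewrite -[u]reprK; move: (repr u) => f; rewrite L2dotE.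
  have fR := Lfun2_Re (valP f); have fI := Lfun2_Im (valP f).
  rewrite (_ : _ - _ = 0); last first.
    by apply/eqP; rewrite subr_eq0; apply/eqP/eq_Rintegral => x _; rewrite mulrC.
  congr Complex; apply: EFin_inj; rewrite sqr_L2norm -RintegralD//; [|exact: integrable_mul..].
  rewrite fineK; last first.
    apply: integrable_fin_num => //.
    exact: (integrableD measurableT (integrable_mul fR fR) (integrable_mul fI fI)).
  by apply: eq_integral => x _; rewrite sqr_normcE.
Qed.

End L2dot_theory.

(** * Completeness of L2 (Riesz-Fischer) *)

(** The telescoping series of the increments converges absolutely. *)
Lemma bounded_variation_cvgn (R : realType) (a : R ^nat) (M : R) :
  (forall n, \sum_(0 <= k < n) `|a k.+1 - a k| <= M) -> cvgn a.
Proof.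
move=> aM; have : cvgn (series (telescope a)).
  apply: (@normed_cvg _ R^o); apply: nondecreasing_is_cvgn.
    apply/nondecreasing_seqP => n; rewrite -subr_ge0 seriesSB; exact: normr_ge0.
  by exists M => _ [n _ <-]; exact: aM.
rewrite telescopeK => /cvg_ex[l al]; apply/cvg_ex; exists (l + a 0%N).
have : (a n - a 0%N) + a 0%N @[n --> \oo] --> l + a 0%N.
  by apply: cvgD => //; exact: cvg_cst.
by under eq_cvg do rewrite subrK.
Qed.

Lemma sum_half_le2 (R : realType) n : \sum_(0 <= k < n) (2^-1 : R) ^+ k <= 2.
Proof.
suff -> : \sum_(0 <= k < n) (2^-1 : R) ^+ k = 2 - 2 * 2^-1 ^+ n.
  by rewrite lerBlDr lerDl mulr_ge0// exprn_ge0// invr_ge0.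
elim: n => [|n IH]; first by rewrite big_geq// expr0 mulr1 subrr.
by rewrite big_nat_recr//= IH exprS mulrA divff//; ring.
Qed.

Section riesz_fischer.
Context {d} {T : measurableType d} {R : realType}.
Variable mu : {measure set T -> \bar R}.
Local Open Scope quotient_scope.

Section fast_cauchy.
Variable u : nat -> L2fun mu.
Hypothesis u_fast : forall n m, (n <= m)%N ->
  L2norm (\pi_(L2 mu) (u m) - \pi_(L2 mu) (u n)) <= 2^-1 ^+ n.

Let D k x : R := normc (u k.+1 x - u k x).

Let mRe (f : L2fun mu) : measurable_fun setT (Re \o f).
Proof. by have := valP f; rewrite inE => -[]. Qed.

Let mIm (f : L2fun mu) : measurable_fun setT (Im \o f).
Proof. by have := valP f; rewrite inE => -[]. Qed.

Let mD2 k : measurable_fun setT (fun x => (2 ^+ k * D k x ^+ 2)%:E).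
Proof.
apply/measurable_EFinP; apply: measurable_funM => //; apply: measurable_funX.
exact: (measurable_normc_L2fun (u k.+1 - u k : L2fun mu)).
Qed.

(** The function sum of [2^k D_k^2] has integral at most the sum of the
    [2^k 4^-k], hence is finite almost everywhere, and it dominates the sum of
    the [D_k] because [D_k <= 2^-k + 2^k D_k^2]. *)
Lemma fast_cauchy_bounded_variation :
  \forall x \ae mu, exists M, forall n, \sum_(0 <= k < n) D k x <= M.
Proof.
pose Q x := (\sum_(k <oo) (2 ^+ k * D k x ^+ 2)%:E)%E.
have D2_ge0 k x : (0 <= (2 ^+ k * D k x ^+ 2)%:E)%E.
  by rewrite lee_fin mulr_ge0 ?sqr_ge0 ?exprn_ge0.
have Q_ge0 x : (0 <= Q x)%E by apply: nneseries_ge0 => k _ _; exact: D2_ge0.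
have mQ : measurable_fun setT Q.
  apply: (@ge0_emeasurable_sum _ _ _ setT (fun k x => (2 ^+ k * D k x ^+ 2)%:E) xpredT) => //.
have intQ : (\int[mu]_x Q x <= 2%:E)%E.
  rewrite integral_nneseries//.
  apply: (@le_trans _ _ (\sum_(k <oo) (2 / (2 ^ k.+1)%:R)%:E)%E); last exact: epsilon_trick0.
  apply: lee_nneseries => [k _ _|k _].
    by apply: integral_ge0 => x _; exact: D2_ge0.
  under eq_integral do rewrite EFinM.
  rewrite ge0_integralZl//; last first.
  - by move=> x _; rewrite lee_fin sqr_ge0.
  - apply/measurable_EFinP/measurable_funX.
    exact: (measurable_normc_L2fun (u k.+1 - u k : L2fun mu)).
  rewrite -(sqr_L2norm (u k.+1 - u k : L2fun mu)) -EFinM lee_fin raddfB/=.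
  have := u_fast (leqnSn k); set N := L2norm _ => Nk.
  have N0 : 0 <= N by rewrite fine_ge0// Lnorm_ge0.
  apply: (@le_trans _ _ (2 ^+ k * (2^-1 ^+ k) ^+ 2)).
    by rewrite ler_pM2l ?exprn_gt0// ler_pXn2r// nnegrE// exprn_ge0// invr_ge0.
  rewrite natrX exprVn [in leRHS]exprS.
  have p0 : (2 : R) ^+ k != 0 by rewrite expf_neq0.
  move: (2 ^+ k) p0 => p p0.
  by rewrite le_eqVlt; apply/orP; left; apply/eqP; field.
have : mu.-integrable setT Q.
  apply/integrableP; split => //; under eq_integral do rewrite gee0_abs//.
  by rewrite (le_lt_trans intQ)// ltry.
move=> /integrable_ae -/(_ measurableT); apply: filterS => x /(_ I) Qfin.
exists (2 + fine (Q x)) => n.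
apply: (@le_trans _ _ (\sum_(0 <= k < n) (2^-1 ^+ k + 2 ^+ k * D k x ^+ 2))).
  apply: ler_sum => k _; set p := 2 ^+ k.
  have p0 : 0 < p by rewrite exprn_gt0.
  rewrite exprVn -/p -subr_ge0.
  have -> : p^-1 + p * D k x ^+ 2 - D k x =
    (p * D k x - 2^-1) ^+ 2 / p + 3 / 4 / p by field; rewrite gt_eqF.
  by rewrite addr_ge0// divr_ge0 ?sqr_ge0 ?ltW.
rewrite big_split/= lerD ?sum_half_le2//.
rewrite -lee_fin fineK// -sumEFin; apply: nneseries_lim_ge => k _ _.
exact: D2_ge0.
Qed.

Let fR x : R := fine (limn_esup (fun n => (Re (u n x))%:E)).
Let fI x : R := fine (limn_esup (fun n => (Im (u n x))%:E)).

(** The limit superior is used because it is measurable and defined everywhere; it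
    is a true limit almost everywhere by [fast_limit_cvg]. *)
Definition fast_limit x : R[i] := fR x +i* fI x.

Let mfR : measurable_fun setT (Re \o fast_limit).
Proof.
apply: (@measurableT_comp _ _ _ _ _ _ fine) => //.
by apply: measurable_fun_limn_esup => n; apply/measurable_EFinP; exact: mRe.
Qed.

Let mfI : measurable_fun setT (Im \o fast_limit).
Proof.
apply: (@measurableT_comp _ _ _ _ _ _ fine) => //.
by apply: measurable_fun_limn_esup => n; apply/measurable_EFinP; exact: mIm.
Qed.

Lemma fast_limit_cvg : \forall x \ae mu,
  Re (u n x) @[n --> \oo] --> Re (fast_limit x) /\
  Im (u n x) @[n --> \oo] --> Im (fast_limit x).
Proof.
apply: filterS fast_cauchy_bounded_variation => x [M DM].
have lim_fine (a : R ^nat) : (forall n, `|a n.+1 - a n| <= D n x) ->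
    a n @[n --> \oo] --> fine (limn_esup (fun n => (a n)%:E)).
  move=> aD; have /cvg_ex[l al] : cvgn a.
    apply: (@bounded_variation_cvgn _ _ M) => n.
    by apply: le_trans (DM n); apply: ler_sum => k _.
  have /cvg_limn_einf_sup[_ ->] // : (a n)%:E @[n --> \oo] --> l%:E.
  by apply/fine_cvgP; split => //; exact/nearW.
split; apply: lim_fine => n; rewrite /D; case: (u n.+1 x) (u n x) => a b [a' b'] /=.
  by rewrite -sqrtr_sqr ler_wsqrtr// lerDl sqr_ge0.
by rewrite -sqrtr_sqr ler_wsqrtr// lerDr sqr_ge0.
Qed.

(** Fatou's lemma for the squared distances from [u m] to [u N], as [m] grows. *)
Lemma fast_limit_dist N :
  (\int[mu]_x ((normc (fast_limit x - u N x)) ^+ 2)%:E <= ((2^-1 ^+ N) ^+ 2)%:E)%E.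
Proof.
have mh m : measurable_fun setT (fun x => ((normc (u m x - u N x)) ^+ 2)%:E).
  apply/measurable_EFinP/measurable_funX.
  exact: (measurable_normc_L2fun (u m - u N : L2fun mu)).
apply: (@le_trans _ _ (\int[mu]_x
    limn_einf (fun m => ((normc (u m x - u N x)) ^+ 2)%:E))%E).
  rewrite le_eqVlt; apply/orP; left; apply/eqP; apply: ae_eq_integral => //.
  - apply/measurable_EFinP/measurable_funX.
    apply: (@measurable_normc _ _ _ (fun x => fast_limit x - u N x)).
      rewrite (_ : _ \o _ = (Re \o fast_limit) \- (Re \o u N)).
        exact: measurable_funB.
      by apply/funext => x /=; case: (u N x).
    rewrite (_ : _ \o _ = (Im \o fast_limit) \- (Im \o u N)).
      exact: measurable_funB.
    by apply/funext => x /=; case: (u N x).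
  - rewrite (_ : (fun x => _) = -%E \o (fun x =>
        limn_esup (-%E \o (fun m => (normc (u m x - u N x) ^+ 2)%:E)))).
      apply: measurableT_comp => //; apply: measurable_fun_limn_esup => m.
      exact: measurableT_comp.
    by apply/funext => x /=; rewrite limn_esupN oppeK.
  apply: filterS fast_limit_cvg => x [uR uI] _.
  apply/esym; apply: (cvg_limn_einf_sup _).1; apply/fine_cvgP; split; first exact/nearW.
  under eq_cvg do rewrite /= sqr_normcE.
  have cRe : Re (u m x - u N x) @[m --> \oo] --> Re (fast_limit x - u N x).
    rewrite ReD; under eq_cvg do rewrite ReD.
    by apply: cvgD => //; exact: cvg_cst.
  have cIm : Im (u m x - u N x) @[m --> \oo] --> Im (fast_limit x - u N x).
    rewrite ImD; under eq_cvg do rewrite ImD.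
    by apply: cvgD => //; exact: cvg_cst.
  by rewrite sqr_normcE; apply: cvgD; exact: cvgM.
apply: le_trans (fatou _ _ _ _) _ => //.
  by move=> n x _; rewrite lee_fin sqr_ge0.
rewrite limn_einf_lim; apply: lime_le; first exact: is_cvg_einfs.
apply/nearW => n; apply: (@le_trans _ _
    (\int[mu]_x ((normc (u (maxn n N) x - u N x)) ^+ 2)%:E)%E).
  by apply: ereal_inf_lbound; exists (maxn n N) => //=; exact: leq_maxl.
rewrite -(sqr_L2norm (u (maxn n N) - u N : L2fun mu)) lee_fin raddfB/=.
rewrite ler_pXn2r ?nnegrE ?exprn_ge0 ?invr_ge0 ?fine_ge0 ?Lnorm_ge0//.
by apply: u_fast; exact: leq_maxr.
Qed.

Lemma fast_cauchy_limit : exists f : L2 mu, forall N,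
  L2norm (f - \pi_(L2 mu) (u N)) <= 2^-1 ^+ N.
Proof.
have dL N : (fun x => fast_limit x - u N x) \in L2pred mu.
  have mR : measurable_fun setT (Re \o (fun x => fast_limit x - u N x)).
    rewrite (_ : _ \o _ = (Re \o fast_limit) \- (Re \o u N)).
      exact: measurable_funB.
    by apply/funext => x /=; case: (u N x).
  have mI : measurable_fun setT (Im \o (fun x => fast_limit x - u N x)).
    rewrite (_ : _ \o _ = (Im \o fast_limit) \- (Im \o u N)).
      exact: measurable_funB.
    by apply/funext => x /=; case: (u N x).
  rewrite inE; split=> //; rewrite /finite_norm unlock poweR_lty//.
  apply: le_lt_trans (ltry ((2^-1 ^+ N) ^+ 2)); apply: le_trans (fast_limit_dist N).
  rewrite le_eqVlt; apply/orP; left; apply/eqP; apply: eq_integral => x _ /=.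
  by rewrite powR_mulrn// ger0_norm// normc_ge0.
pose g N : L2fun mu := MkL2fun (dL N).
exists (\pi_(L2 mu) (g 0%N + u 0%N)) => N.
rewrite -raddfB/= (_ : g 0%N + u 0%N - u N = g N); last first.
  apply/val_inj/funext => x.
  rewrite -[LHS]/(fast_limit x - u 0%N x + u 0%N x - u N x).
  by rewrite subrK.
rewrite -(@ler_pXn2r _ 2) ?nnegrE ?exprn_ge0 ?invr_ge0 ?fine_ge0 ?Lnorm_ge0//.
by rewrite -lee_fin sqr_L2norm; exact: fast_limit_dist.
Qed.

End fast_cauchy.

(** A Cauchy filter has balls of radius [2^-n / 2] among its members; their
    centres are a fast Cauchy sequence, whose limit is that of the filter. *)
Lemma L2_complete (G : set_system (L2 mu)) : ProperFilter G -> cauchy G -> cvg G.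
Proof.
move=> GG /cauchyP cG.
have half_gt0 n : 0 < (2^-1 : R) ^+ n by rewrite exprn_gt0// invr_gt0.
have /choice[v Gv] n : exists v : L2 mu, G (ball v ((2^-1 ^+ n) / 2)%:C).
  by apply: cG; rewrite ltcR divr_gt0.
have ballE (f : L2 mu) (e : R) g : ball f e%:C g = (rnorm (f - g) < e) :> Prop.
  by rewrite -ball_normE /ball_ /= rnormE ltcR.
have v_fast n m : (n <= m)%N -> rnorm (v m - v n) <= 2^-1 ^+ n.
  move=> nm; have [w [nw mw]] := filter_ex (filterI (Gv n) (Gv m)).
  rewrite ballE in nw; rewrite ballE in mw.
  rewrite -(subrKA w) (le_trans (rnormD _ _))// [leRHS]splitr lerD//.
    rewrite (le_trans (ltW mw))// ler_pM2r// ler_wiXn2l// ?invr_ge0//.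
    by rewrite invf_le1// ler1n.
  by rewrite rnormB ltW.
have [|f vf] := @fast_cauchy_limit (fun n => repr (v n)).
  by move=> n m nm; rewrite !reprK; exact: v_fast.
apply/cvg_ex; exists f; apply/cvg_rnormP => e e0.
have : (2^-1 : R) ^+ n @[n --> \oo] --> (0 : R).
  by apply: cvg_expr; rewrite ger0_norm ?invr_ge0// invf_lt1// ltr1n.
move=> /cvgrPdist_lt/(_ (e / 2)) [|N _ /(_ N (leqnn N))]; first by rewrite divr_gt0.
rewrite /= sub0r normrN ger0_norm ?ltW// => Ne.
apply: filterS (Gv N) => g; rewrite ballE => vg.
have := vf N; rewrite reprK -[L2norm _]/(rnorm (f - v N)) => fv.
rewrite -(subrKA (v N)) (le_lt_trans (rnormD _ _))// [ltRHS]splitr ler_ltD//.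
  exact: le_trans fv (ltW Ne).
rewrite (lt_trans vg)// (lt_trans _ Ne)// ltr_pdivrMr// ltr_pMr// ltr1n.
by [].
Qed.

End riesz_fischer.

HB.instance Definition _ d (T : measurableType d) (R : realType)
    (mu : {measure set T -> \bar R}) :=
  Uniform_isComplete.Build (L2 mu) (@L2_complete d T R mu).


(** * Translations by the lattice of the Heisenberg group *)

Section L2comp_theory.
Context {d} {T : measurableType d} {R : realType}.
Variable mu : {measure set T -> \bar R}.
Variables (h : T -> T) (mh : measurable_fun setT h) (ph : preserves mu h).
Local Open Scope quotient_scope.

Lemma L2comp_linear (a : R[i]) (u v : L2 mu) :
  L2comp mh ph (a *: u + v) = a *: L2comp mh ph u + L2comp mh ph v.
Proof.
rewrite -[u]reprK -[v]reprK; move: (repr u) (repr v) => f g.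
rewrite -[a *: \pi_(L2 mu) f]/(L2scale a _) pi_L2scale -raddfD/= !pi_L2comp.
rewrite -[a *: \pi_(L2 mu) _]/(L2scale a _) pi_L2scale -raddfD/=.
by congr (\pi_(L2 mu)); exact/val_inj.
Qed.

Lemma rnorm_L2comp (u : L2 mu) : rnorm (L2comp mh ph u) = rnorm u.
Proof.
rewrite -[u]reprK; move: (repr u) => f; rewrite pi_L2comp.
apply: EFin_inj; rewrite -![rnorm _]/(L2norm _) !pi_L2normE.
rewrite -(Lnorm_comp mh ph (f := EFin \o normc \o f))//.
by apply/measurable_EFinP; exact: measurable_normc_L2fun.
Qed.

End L2comp_theory.

Section heisenberg_theory.
Variables (R : realType) (n : nat).
Implicit Types (X Y Z : heis R n) (u v : L2 (@haar R n)) (p q : lattice n).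
Local Open Scope quotient_scope.

Lemma tnth_tuple_add (x y : n.-tuple (measurableTypeR R)) i :
  tnth (tuple_add x y) i = tnth x i + tnth y i.
Proof. exact: tnth_mktuple. Qed.

Lemma tuple_addA : associative (@tuple_add R n).
Proof. by move=> x y z; apply: eq_from_tnth => i; rewrite !tnth_mktuple addrA. Qed.

Lemma Im_hermCDl X Y Z :
  Im (Defs.hermC (hmul X Y).1 Z.1) = Im (Defs.hermC X.1 Z.1) + Im (Defs.hermC Y.1 Z.1).
Proof.
rewrite !Im_hermC -big_split; apply: eq_bigr => j _ /=.
by rewrite !tnth_tuple_add; ring.
Qed.

Lemma Im_hermCDr X Y Z :
  Im (Defs.hermC X.1 (hmul Y Z).1) = Im (Defs.hermC X.1 Y.1) + Im (Defs.hermC X.1 Z.1).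
Proof.
rewrite !Im_hermC -big_split; apply: eq_bigr => j _ /=.
by rewrite !tnth_tuple_add; ring.
Qed.

Lemma hmulA : associative (@hmul R n).
Proof.
move=> X Y Z; rewrite {1}/hmul [RHS]/hmul Im_hermCDl Im_hermCDr /= !tuple_addA.
by congr pair; ring.
Qed.

Lemma hmul1x : left_id (hone R n) (@hmul R n).
Proof.
move=> [[x y] t]; rewrite /hmul /hone /= Im_hermC big1 => [|j _]; last first.
  by rewrite /= !tnth_mktuple !mul0r subrr.
by congr (_, _, _); rewrite ?mulr0 ?addr0 ?add0r//;
  apply: eq_from_tnth => i; rewrite !tnth_mktuple add0r.
Qed.

Lemma hmulx1 : right_id (hone R n) (@hmul R n).
Proof. by move=> X; rewrite -(hmulVx X) hmulA hmulxV hmul1x. Qed.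

Lemma hinvM X Y : hinv (hmul X Y) = hmul (hinv Y) (hinv X).
Proof.
have E : hmul (hmul (hinv Y) (hinv X)) (hmul X Y) = hone R n.
  by rewrite hmulA -[hmul _ X]hmulA hmulVx hmulx1 hmulVx.
by rewrite -[LHS]hmul1x -{1}E -hmulA hmulxV hmulx1.
Qed.

Lemma hinv1 : hinv (hone R n) = hone R n.
Proof. by rewrite -[LHS]hmulx1 hmulVx. Qed.

Lemma translationM X Y u : translation X (translation Y u) = translation (hmul X Y) u.
Proof.
rewrite -[u]reprK; move: (repr u) => f; rewrite /translation !(pi_L2comp _ _ f) pi_L2comp.
congr (\pi_(L2 (@haar R n))); apply/val_inj/funext => Z /=.
by rewrite hinvM -hmulA.
Qed.

Lemma translation1 u : translation (hone R n) u = u.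
Proof.
rewrite -[u]reprK; move: (repr u) => f; rewrite /translation !pi_L2comp.
congr (\pi_(L2 (@haar R n))); apply/val_inj/funext => Z /=.
by rewrite hinv1 hmul1x.
Qed.

(** The Heisenberg law read on integer coordinates: the factor 2 of
    [lattice_point] cancels the one half of [hmul]. *)
Definition lattice_mul p q : lattice n :=
  (([tuple tnth p.1.1 i + tnth q.1.1 i | i < n],
    [tuple tnth p.1.2 i + tnth q.1.2 i | i < n]),
   p.2 + q.2 + \sum_(j < n) (tnth p.1.2 j * tnth q.1.1 j - tnth p.1.1 j * tnth q.1.2 j)).

Definition lattice_inv p : lattice n :=
  (([tuple - tnth p.1.1 i | i < n], [tuple - tnth p.1.2 i | i < n]), - p.2).

Definition lattice_one : lattice n := (([tuple 0 | _ < n], [tuple 0 | _ < n]), 0).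

Lemma lattice_mulK p : cancel (lattice_mul p) (lattice_mul (lattice_inv p)).
Proof.
move=> [[k l] m]; rewrite /lattice_mul/=; congr (_, _, _).
- by apply: eq_from_tnth => i; rewrite !tnth_mktuple addKr.
- by apply: eq_from_tnth => i; rewrite !tnth_mktuple addKr.
rewrite -[- p.2 + _ + _]addrA -!addrA addKr -big_split/= big1 ?addr0// => j _.
by rewrite !tnth_mktuple; ring.
Qed.

Lemma lattice_mulVK p : cancel (lattice_mul (lattice_inv p)) (lattice_mul p).
Proof.
have {2}-> : p = lattice_inv (lattice_inv p); last exact: lattice_mulK.
case: p => [[k l] m]; rewrite /lattice_inv/= opprK; congr (_, _, _);
  by apply: eq_from_tnth => i; rewrite !tnth_mktuple opprK.
Qed.

Lemma lattice_pointM p q : lattice_point R (lattice_mul p q) =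
  hmul (lattice_point R p) (lattice_point R q).
Proof.
rewrite /lattice_point /hmul/= Im_hermC/=; congr (_, _, _).
- by apply: eq_from_tnth => i; rewrite !tnth_mktuple rmorphD/= mulrDr.
- by apply: eq_from_tnth => i; rewrite !tnth_mktuple rmorphD.
rewrite !rmorphD/= rmorph_sum/= mulr_sumr; congr (_ + _).
apply: eq_bigr => j _; rewrite !tnth_mktuple rmorphB !rmorphM/=.
by field.
Qed.

Lemma lattice_point1 : lattice_point R lattice_one = hone R n.
Proof.
rewrite /lattice_point /hone/=; congr (_, _, _);
  by apply: eq_from_tnth => i; rewrite !tnth_mktuple ?mulr0.
Qed.

Lemma translatesM (phi : L2 (@haar R n)) p q :
  translation (lattice_point R p) (translates phi q) =
  translates phi (lattice_mul p q).
Proof. by rewrite /translates translationM lattice_pointM. Qed.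

Lemma translates1 (phi : L2 (@haar R n)) : translates phi lattice_one = phi.
Proof. by rewrite /translates lattice_point1 translation1. Qed.

End heisenberg_theory.

Theorem theorem6p3 (R : realType) (n : nat) (phi : L2 (@haar R n)) :
  let V := closed_span (translates phi) in
  let S := frame_operator (@L2dot _ _ _ (@haar R n)) (translates phi) in
  is_frame (@L2dot _ _ _ (@haar R n)) V (translates phi) ->
  set_bij V V S /\
  exists phit : L2 (@haar R n), [/\ V phit,
    phit = 'pinv_(fun=> 0) V S phi &
    forall f, V f ->
      partial_sum (fun p => L2dot f (translates phit p) *: translates phi p) A
        @[A --> totally] --> f].
Proof.
move=> V S /is_frame_bounds[A [B [A0 B0 frame_le frame_ge]]].
have dotP := L2dot_inner_product (@haar R n).
have Sbij : set_bij V V S by exact: (frame_operator_bij dotP A0 B0 frame_le frame_ge).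
have [_ _ Ssurj] := Sbij.
have Vphi : V phi by rewrite -[X in V X]translates1; exact: closed_span_gen.
set phit := 'pinv_(fun=> 0) V S phi.
have Vphit : V phit by apply: (surjpinv_image_sub Ssurj); exists phi.
have Sphit : S phit = phi by exact: (surjpK _ Ssurj (mem_set Vphi)).
split=> //; exists phit; split=> //.
pose U (p : lattice n) : L2 (@haar R n) -> L2 (@haar R n) :=
  translation (lattice_point R p).
have U_lin p (a : R[i]) f g : U p (a *: f + g) = a *: U p f + U p g.
  exact: L2comp_linear.
have U_dot p f g : L2dot (U p f) (U p g) = L2dot f g.
  by apply: (polarization dotP (U_lin p)) => {f g} f; exact: rnorm_L2comp.
exact: (frame_symmetric_dual dotP A0 B0 frame_le frame_ge
  (@lattice_mulK n) (@lattice_mulVK n) U_lin U_dot (translatesM phi)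
  (fun=> erefl) Vphit Sphit).
Qed.
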